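(* There is a constant $C\ge e$ such that the following holds for any $\tau\in(0,1)$. If an integer $k=k(n)\ge 2$ and the edge-probability $p=p(n)$ satisfy $$n^{-1+\tau}\le p\le (6C)^{-1}\cdot\big[k^2\log(1/p)\,np\big]^{-1/(2(k-1))}\cdot(1-p^k)^{n/(k-1)}$$ and $$\max\big\{np^2,\ p^{-(k-2)/2}\big\}\cdot(1-p^k)^{n(k-2)/(k-1)}\ \ge\ \mathbb{1}\{k\ge 3\}\,k^5\log(1/p),$$ then with high probability $$\chi_c(G_{n,p})\ \ge\ \frac{1}{C^2}\cdot\min\left\{\frac1p,\ \frac{p^{k/2}n}{\big[k!\,k\log(1/p)\big]^{1/(k-1)}}\right\}\cdot(1-p^k)^{n/(k-1)}.$$
   Context: $G_{n,p}$ denotes the binomial random graph on vertex set $[n]$ in which each pair of vertices is an edge independently with probability $p$. The clique chromatic number $\chi_c(G)$ is the smallest number of colors in a vertex coloring of $G$ such that no inclusion-maximal clique of $G$ is monochromatic (maximal cliques consisting of a single isolated vertex are ignored). $\mathbb{1}\{k\ge3\}$ is $1$ if $k\ge 3$ and $0$ otherwise. ''With high probability'' means with probability tending to $1$ as $n\to\infty$; $\log$ is the natural logarithm. *)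

(* Defs.v *)
From HB Require Import structures.
From mathcomp Require Import all_boot all_order all_algebra.
From mathcomp Require Import all_classical all_reals all_analysis.
Set Implicit Arguments.
Unset Strict Implicit.
Unset Printing Implicit Defensive.
Import Order.TTheory GRing.Theory Num.Theory.
Import numFieldNormedType.Exports.

Local Open Scope ring_scope.

Section Graphs.
Variable T : finType.

Definition vpair := {e : {set T} | #|e| == 2}.

(* A simple graph on T is given by its set of edges. *)
Definition graph := {set vpair}.

Implicit Types (G : graph) (S : {set T}).

Definition adj G : rel T := fun x y => [set x; y]%SET \in val @: G.

Definition clique G S : bool :=
  [forall x in S, forall y in S, (x != y) ==> adj G x y].

(* Singletons and the empty set count as cliques; a maximal clique with at
   most one vertex (an isolated vertex, or set0 when T is empty) imposes no
   condition on a colouring, whence 1 < #|S| below. *)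
Definition maximal_clique G S : bool := maxset (clique G) S.

Definition monochromatic q (c : {ffun T -> 'I_q}) S : bool :=
  [forall x in S, forall y in S, c x == c y].

Definition clique_coloring G q (c : {ffun T -> 'I_q}) : bool :=
  [forall S : {set T},
     maximal_clique G S && (1 < #|S|)%N ==> ~~ monochromatic c S].

Definition clique_colorable G q : bool :=
  [exists c : {ffun T -> 'I_q}, clique_coloring G c].

Lemma clique_colorable_card G : clique_colorable G #|T|.
Proof.
apply/existsP; exists [ffun x => enum_rank x]; apply/forallP => S.
apply/implyP => /andP[_ /card_gt1P[x [y [xS yS xy]]]].
apply: contraNN xy => /forall_inP/(_ x xS)/forall_inP/(_ y yS).
by rewrite !ffunE => /eqP/enum_rank_inj ->.
Qed.

Lemma ex_clique_colorable G : exists q, clique_colorable G q.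
Proof. by exists #|T|; exact: clique_colorable_card. Qed.

Definition clique_chromatic_number G : nat := ex_minn (ex_clique_colorable G).

End Graphs.

Section BinomialRandomGraph.
Variable R : realType.
Implicit Types (n : nat) (p : R).

Definition Gnp_weight n p (G : graph 'I_n) : R :=
  \prod_(e : vpair 'I_n) (if e \in G then p else 1 - p).

Definition Gnp_prob n p (A : pred (graph 'I_n)) : R :=
  \sum_(G : graph 'I_n | A G) Gnp_weight p G.

Lemma Gnp_prob_total n p : @Gnp_prob n p xpredT = 1.
Proof.
rewrite /Gnp_prob /Gnp_weight.
have E : \prod_(e : vpair 'I_n) (p + (1 - p)) = 1.
  by apply: big1 => e _; rewrite addrC subrK.
by rewrite -[RHS]E bigA_distr; apply: eq_bigl => G; rewrite inE.
Qed.

End BinomialRandomGraph.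

(* Main.v *)
Require Import Defs.
From HB Require Import structures.
From mathcomp Require Import all_boot all_order all_algebra.
From mathcomp Require Import all_classical all_reals all_analysis.
From mathcomp Require Import fintype finset ring lra zify.
Import Order.TTheory GRing.Theory Num.Theory.
Import numFieldNormedType.Exports.

(** If fewer than [q] colours suffice, some colour class contains a set [S] of
    [s] > n/q vertices in which every k-clique has a common neighbour outside
    [S]: a k-clique without one would extend to a maximal clique inside [S].
    We show that with high probability no [S] has this property, by a union
    bound over [S].

    Reveal first the edges leaving [S].  The number of k-subsets of [S] without
    common neighbour outside [S] has expectation about [(1-p^k)^n 'C(s,k)].  Its
    lower tail is controlled by a bounded-difference inequality, which needs
    small differences: the vertices sending more than [C/10 p s] edges into [S]
    are set aside, an entropy estimate shows that they cover at most half of the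
    k-subsets, and the neighbourhoods of the others are truncated to their first
    [C/10 p s] elements, which makes the edge-wise differences bounded without
    any conditioning.  Then reveal the edges inside [S]: Janson's inequality
    shows that one of the uncovered k-subsets is a clique.

    Every failure probability is at most [e^(1 - 2 s log(1/p))], while there are
    at most [e^(s log(1/p) - s)] sets [S]. *)

Set Implicit Arguments.
Unset Strict Implicit.
Unset Printing Implicit Defensive.

Local Open Scope ring_scope.

(** * Product Bernoulli measures on the subsets of a finite type *)

Section BernoulliProduct.
Context {R : realType} {T : finType}.
Variable p : R.
Hypotheses (p0 : 0 <= p) (p1 : p <= 1).
Implicit Types (A B U : {set T}) (f g : {set T} -> R) (l : seq T).

(** The heavy vertices cannot simply be set aside: which they are depends on the edges whose
    randomness the lower tail needs. They are replaced by an arbitrary fixed set [B] outside [S]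
    with at most 40L/(Cp) elements, L = log(1/p). The edges from [B] to [S] are frozen, the tail
    bound uses the remaining edges leaving [S], and a union bound over [B] costs e^(1+sL), which the
    exponent 13sL of [survivors_failure] absorbs. Only then is the actual heavy set substituted for
    [B].

    With M = floor(C/10 p s) and phi = (1-p^k)^n, the upper bound on p balances the mean phi C(s,k)
    of the survivors against a variance of order s n p C(M-1,k-1)^2; its factor 6C is 60 times the
    truncation factor C/10. For s = floor(n/q)+1, the term 1/p of the minimum yields [s_degree],
    which pays for the choice of [S] and keeps degrees small relative to s. The other term yields
    [s_cliques]. Either of the two, according to which entry of the maximum is larger, turns the
    condition for k >= 3 into [s_pairs]. [s_cliques] and [s_pairs] control Janson's correlation sum
    at its extreme overlaps, k and 2 shared vertices. *)

Definition weight A : R := \prod_(e : T) (if e \in A then p else 1 - p).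
Definition expect f : R := \sum_(A : {set T}) weight A * f A.
(** This is conditional expectation given all coordinates other than [e]. Inequalities are proved
    pointwise for iterated averages, by induction on the list of coordinates; averaging over
    [enum T] leaves the constant [expect f]. This replaces filtrations and martingales. *)
Definition avg (e : T) f A : R := p * f (e |: A)%SET + (1 - p) * f (A :\ e)%SET.
Definition avgs l f := foldr avg f l.

Let q0 : 0 <= 1 - p. Proof. by rewrite subr_ge0. Qed.

Lemma weight_ge0 A : 0 <= weight A.
Proof.
by apply: prodr_ge0 => e _; case: ifP => _ //; rewrite subr_ge0.
Qed.

Lemma expect_split (e : T) f :
  expect f = \sum_(A : {set T} | e \notin A)
    (\prod_(x | x != e) (if x \in A then p else 1 - p)) *
    (p * f (e |: A)%SET + (1 - p) * f A).
Proof.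
rewrite /expect (bigID (fun A : {set T} => e \notin A)) /=.
rewrite [X in _ + X](reindex_onto (fun A => e |: A)%SET (fun A => A :\ e)%SET) /=; last first.
  by move=> A; rewrite negbK => eA; rewrite setD1K.
rewrite [X in _ + X](eq_bigl (fun A : {set T} => e \notin A)); last first.
  move=> A; rewrite setU11 /=; apply/eqP/idP => [<-|]; first by rewrite !inE eqxx.
  exact: setU1K.
rewrite -big_split /=; apply: eq_bigr => A eA.
rewrite /weight (bigD1 e) //= (negbTE eA) [X in _ + X * _](bigD1 e) //= setU11.
under [X in _ + _ * X * _]eq_bigr => x xe do rewrite !inE (negbTE xe) /=.
ring.
Qed.

Lemma expect_avg e f : expect f = expect (avg e f).
Proof.
rewrite !(expect_split e); apply: eq_bigr => A eA; congr (_ * _).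
rewrite /avg setU1K // setUA setUid.
have -> : (A :\ e = A)%SET by apply/setDidPl; rewrite disjoint_sym disjoints1.
ring.
Qed.

Lemma expect_avgs l f : expect f = expect (avgs l f).
Proof. by elim: l => //= e l ->; exact: expect_avg. Qed.

Lemma avgs_outside l f A B : {in [predC l], A =i B} -> avgs l f A = avgs l f B.
Proof.
elim: l A B => [|e l IH] A B AB /=.
  by congr f; apply/setP => x; exact: AB.
rewrite /avg; congr (_ * _ + _ * _); apply: IH => x xl; rewrite !inE;
  case: eqVneq => //= xe; apply: AB; move: xl; by rewrite !inE negb_or xe.
Qed.

Lemma expect_cst (c : R) : expect (fun=> c) = c.
Proof.
rewrite /expect -mulr_suml; suff -> : \sum_A weight A = 1 by rewrite mul1r.
have E : \prod_(e : T) (p + (1 - p)) = 1 by apply: big1 => e _; ring.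
by rewrite -[RHS]E bigA_distr; apply: eq_bigl => A; rewrite inE.
Qed.

Lemma avgs_enum f A : avgs (enum T) f A = expect f.
Proof.
rewrite (expect_avgs (enum T)) -[LHS]expect_cst; apply: eq_bigr => B _; congr (_ * _).
by apply: avgs_outside => x; rewrite !inE mem_enum.
Qed.

Lemma ler_expect f g : (forall A, f A <= g A) -> expect f <= expect g.
Proof. by move=> fg; apply: ler_sum => A _; rewrite ler_wpM2l ?weight_ge0. Qed.

Lemma eq_expect f g : f =1 g -> expect f = expect g.
Proof. by move=> fg; apply: eq_bigr => A _; rewrite fg. Qed.

Lemma expectZ c f : expect (fun A => c * f A) = c * expect f.
Proof. by rewrite /expect mulr_sumr; apply: eq_bigr => A _; ring. Qed.

Lemma expectD f g : expect (fun A => f A + g A) = expect f + expect g.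
Proof. by rewrite /expect -big_split; apply: eq_bigr => A _ /=; ring. Qed.

Lemma expect_sum (I : Type) (r : seq I) (P : pred I) (F : I -> {set T} -> R) :
  expect (fun A => \sum_(i <- r | P i) F i A) = \sum_(i <- r | P i) expect (F i).
Proof.
rewrite /expect exchange_big; apply: eq_bigr => A _; by rewrite mulr_sumr.
Qed.

Lemma expect_ge0 f : (forall A, 0 <= f A) -> 0 <= expect f.
Proof. by move=> f0; apply: sumr_ge0 => A _; rewrite mulr_ge0 ?weight_ge0. Qed.

Definition incr f := forall A B, A \subset B -> f A <= f B.
Definition decr f := forall A B, A \subset B -> f B <= f A.

Lemma avgs_incr l f : incr f -> incr (avgs l f).
Proof.
elim: l => //= e l IH /IH{}IH A B AB; rewrite /avg lerD // ler_wpM2l //.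
  by apply: IH; rewrite setUS.
by apply: IH; rewrite setSD.
Qed.

Lemma avgs_decr l f : decr f -> decr (avgs l f).
Proof.
elim: l => //= e l IH /IH{}IH A B AB; rewrite /avg lerD // ler_wpM2l //.
  by apply: IH; rewrite setUS.
by apply: IH; rewrite setSD.
Qed.

Lemma sub_avg e A : (A :\ e \subset e |: A)%SET.
Proof. exact: subset_trans (subsetDl _ _) (subsetUr _ _). Qed.

(** Averaging preserves monotonicity, so each step is the two-point case: the product of the means
    exceeds the mean of the products by p(1-p)(a1-a0)(b0-b1), which is nonnegative. *)
Lemma avgs_harris l f g A : incr f -> decr g ->
  avgs l (fun B => f B * g B) A <= avgs l f A * avgs l g A.
Proof.
move=> fi gd; elim: l A => //= e l IH A; rewrite /avg.
have := IH (e |: A)%SET; have := IH (A :\ e)%SET.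
have := avgs_incr l fi (sub_avg e A).
have := avgs_decr l gd (sub_avg e A).
set e1 := (e |: A)%SET; set e0 := (A :\ e)%SET.
set a1 := avgs l f e1; set b1 := avgs l g e1.
set a0 := avgs l f e0; set b0 := avgs l g e0.
set c1 := avgs l _ e1; set c0 := avgs l _ e0 => hb ha h0 h1.
have H1 : p * c1 <= p * (a1 * b1) by apply: ler_wpM2l.
have H0 : (1 - p) * c0 <= (1 - p) * (a0 * b0) by apply: ler_wpM2l.
have H2 : 0 <= (p * (1 - p)) * ((a1 - a0) * (b0 - b1)).
  by apply: mulr_ge0; apply: mulr_ge0; rewrite // subr_ge0.
lra.
Qed.

Lemma expect_avgs_enum f : expect f = avgs (enum T) f set0.
Proof. by rewrite avgs_enum. Qed.

Lemma harris f g : incr f -> decr g ->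
  expect (fun A => f A * g A) <= expect f * expect g.
Proof. by move=> fi gd; rewrite !expect_avgs_enum; exact: avgs_harris. Qed.

Lemma harris_decr f g : decr f -> decr g ->
  expect f * expect g <= expect (fun A => f A * g A).
Proof.
move=> fd gd.
have fi : incr (fun A => - f A) by move=> A B AB; rewrite lerN2; exact: fd.
have := harris fi gd; under eq_expect => A do rewrite -mulrN1 -mulrA mulrCA.
rewrite expectZ; under [X in _ <= X * _]eq_expect => A do rewrite -mulN1r.
by rewrite expectZ !mulN1r mulNr lerN2.
Qed.

Lemma harris_decr_prod (I : Type) (r : seq I) (P : pred I) (F : I -> {set T} -> R) :
  (forall i, decr (F i)) -> (forall i A, 0 <= F i A) ->
  \prod_(i <- r | P i) expect (F i) <= expect (fun A => \prod_(i <- r | P i) F i A).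
Proof.
move=> Fd F0.
have Hd s : decr (fun A => \prod_(i <- s | P i) F i A).
  by move=> A B AB; apply: ler_prod => i _; rewrite F0 Fd.
elim: r => [|i r IH].
  by rewrite big_nil; under eq_expect => A do rewrite big_nil; rewrite expect_cst.
rewrite big_cons; under [X in _ <= X]eq_expect => A do rewrite big_cons.
case: ifP => // _; apply: le_trans (harris_decr _ _) => //.
by apply: ler_wpM2l => //; exact: expect_ge0.
Qed.

Definition depends U f := forall A B, A :&: U = B :&: U -> f A = f B.

Lemma depends_avgs U l f : depends U f -> depends U (avgs l f).
Proof.
elim: l => //= e l IH /IH{}IH A B AB; rewrite /avg.
congr (_ * _ + _ * _); apply: IH; apply/setP => x;
  by move/setP/(_ x): AB; rewrite !inE; case: eqVneq => //= ->.
Qed.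

(** Each coordinate is ignored by one of the two factors, and averaging over it then acts on the
    other factor alone. *)
Lemma avgs_indep U l f g A : depends U f -> depends (~: U) g ->
  avgs l (fun B => f B * g B) A = avgs l f A * avgs l g A.
Proof.
move=> fU gU; elim: l A => //= e l IH A; rewrite /avg !IH.
have same V B (h : {set T} -> R) : depends V h -> e \notin V ->
    h (e |: B)%SET = h (B :\ e)%SET.
  move=> hV eV; apply: hV; apply/setP => x; rewrite !inE.
  by case: eqVneq => //= ->; rewrite (negbTE eV).
case: (boolP (e \in U)) => eU.
  by rewrite (same _ _ _ (depends_avgs l gU)) ?inE ?negbK //; ring.
by rewrite (same _ _ _ (depends_avgs l fU)) //; ring.
Qed.

Lemma expect_indep U f g : depends U f -> depends (~: U) g ->
  expect (fun A => f A * g A) = expect f * expect g.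
Proof. by move=> fU gU; rewrite !expect_avgs_enum; exact: avgs_indep fU gU. Qed.

Lemma depends_sub (U V : {set T}) f : U \subset V -> depends U f -> depends V f.
Proof.
move=> UV fU A B AB; apply: fU.
by rewrite -(setIidPr UV) !setIA AB.
Qed.

Lemma expect_prod_indep (I : eqType) (r : seq I) (V : I -> {set T})
    (F : I -> {set T} -> R) : uniq r ->
  (forall i j, i \in r -> j \in r -> i != j -> [disjoint V i & V j]) ->
  (forall i, i \in r -> depends (V i) (F i)) ->
  expect (fun A => \prod_(i <- r) F i A) = \prod_(i <- r) expect (F i).
Proof.
elim: r => [|i r IH] /= ur dV FV.
  by rewrite big_nil; under eq_expect => A do rewrite big_nil; rewrite expect_cst.
rewrite big_cons; under [LHS]eq_expect => A do rewrite big_cons.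
case/andP: ur => ir ur; rewrite (expect_indep (U := V i)) //.
- rewrite IH // => [j1 j2 h1 h2|j jr]; first by apply: dV; rewrite inE ?h1 ?h2 orbT.
  by apply: FV; rewrite inE jr orbT.
- by apply: FV; rewrite mem_head.
move=> A B AB; apply: eq_big_seq => j jr.
apply: (depends_sub _ (FV j _)) AB; last by rewrite inE jr orbT.
rewrite -disjoints_subset disjoint_sym.
by apply: dV; rewrite ?mem_head ?inE ?jr ?orbT //; apply: contraNneq ir => ->.
Qed.

Lemma expect_subset U : expect (fun A => (U \subset A)%:R) = p ^+ #|U|.
Proof.
have E1 e : expect (fun A => (e \in A)%:R) = p.
  rewrite (expect_avg e) -[RHS]expect_cst; apply: eq_expect => A.
  by rewrite /avg !inE eqxx /=; ring.
have sE A : (U \subset A)%:R = \prod_(e <- enum U) ((e \in A)%:R : R).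
  rewrite -natr_prod; congr _%:R.
  apply/esym; case: (boolP (U \subset A)) => UA.
    by rewrite big1_seq // => e; rewrite mem_enum => /(subsetP UA) ->.
  case/subsetPn: UA => e eU eA; rewrite (bigD1_seq e) ?mem_enum ?enum_uniq //=.
  by rewrite (negbTE eA).
under eq_expect => A do rewrite sE.
rewrite (@expect_prod_indep _ _ (fun e => [set e])) ?enum_uniq //.
- by under eq_bigr => e _ do rewrite E1; rewrite big_enum /= prodr_const.
- by move=> i j _ _ ij; rewrite disjoints1 inE.
move=> e _ A B /setP/(_ e); rewrite !inE eqxx !andbT => AB; by rewrite AB.
Qed.

Definition prob (P : pred {set T}) := expect (fun A => (P A)%:R).

Lemma prob_le1 P : prob P <= 1.
Proof. by rewrite -(expect_cst 1); apply: ler_expect => A; case: (P A). Qed.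

Lemma prob_sub (P Q : pred {set T}) : (forall A, P A -> Q A) -> prob P <= prob Q.
Proof.
by move=> PQ; apply: ler_expect => A; case: (boolP (P A)) => // /PQ ->.
Qed.

Lemma prob_markov (P : pred {set T}) f : (forall A, 0 <= f A) ->
  (forall A, P A -> 1 <= f A) -> prob P <= expect f.
Proof.
by move=> f0 Pf; apply: ler_expect => A; case: (boolP (P A)) => // /Pf.
Qed.

Lemma prob_exists (I : finType) (Q : pred I) (P : I -> pred {set T}) :
  prob (fun A => [exists i, Q i && P i A]) <= \sum_(i | Q i) prob (P i).
Proof.
rewrite -expect_sum; apply: ler_expect => A.
case: existsP => [[i /andP[Qi Pi]]|_] /=; last by apply: sumr_ge0.
by rewrite (bigD1 i) //= Pi lerDl sumr_ge0.
Qed.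

Lemma prob_or P Q : prob (fun A => P A || Q A) <= prob P + prob Q.
Proof.
rewrite -expectD; apply: ler_expect => A.
by case: (P A); case: (Q A); rewrite /= ?addr0 ?add0r ?ler01 // lerDl.
Qed.

(* Conditioning on [X], which is independent of every [Y i]. *)
Lemma prob_freeze (I : finType) U (X : {set T} -> I) (Q : pred I)
    (Y : I -> pred {set T}) (eps : R) :
  (forall A B, A :&: U = B :&: U -> X A = X B) ->
  (forall i, depends (~: U) (fun A => (Y i A)%:R)) -> 0 <= eps ->
  (forall i, Q i -> prob (Y i) <= eps) ->
  prob (fun A => Q (X A) && Y (X A) A) <= eps.
Proof.
move=> XU YU eps0 Yeps.
have -> : prob (fun A => Q (X A) && Y (X A) A) =
    \sum_(i | Q i) expect (fun A => (X A == i)%:R * (Y i A)%:R).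
  rewrite -expect_sum; apply: eq_expect => A.
  case: (boolP (Q (X A))) => /= QX.
    rewrite (bigD1 (X A)) //= eqxx mul1r big1 ?addr0 // => i /andP[_ iX].
    by rewrite eq_sym (negbTE iX) mul0r.
  rewrite big1 // => i Qi; case: eqVneq => [E|]; last by rewrite mul0r.
  by rewrite E Qi in QX.
apply: (@le_trans _ _ (\sum_(i | Q i) eps * expect (fun A => (X A == i)%:R))).
  apply: ler_sum => i Qi; rewrite (expect_indep (U := U)) //; last first.
    by move=> A B /XU ->.
  by rewrite mulrC ler_wpM2r ?Yeps // expect_ge0.
rewrite -mulr_sumr -[X in _ <= X]mulr1 ler_wpM2l // -expect_sum -[X in _ <= X](expect_cst 1).
apply: ler_expect => A; case: (boolP (Q (X A))) => QX.
  rewrite (bigD1 (X A)) //= eqxx big1 ?addr0 // => i /andP[_ iX].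
  by rewrite eq_sym (negbTE iX).
rewrite big1 // => i Qi; case: eqVneq => // E; by rewrite E Qi in QX.
Qed.

End BernoulliProduct.

(** * Lower tails and Janson's inequality *)

Section ExponentialInequalities.
Context {R : realType}.
Implicit Types p x d : R.

(** From (1-x)e^x <= 1 and (1-x)(1+x+2x^2) = 1 + x^2(1-2x) >= 1. *)
Lemma expR_quadratic x : x <= 1 / 2 -> expR x <= 1 + x + 2 * x ^+ 2.
Proof.
move=> x2; have h := expR_ge1Dx (- x).
have e0 : 0 < expR x by exact: expR_gt0.
have h1 : (1 - x) * expR x <= 1.
  by rewrite -[leRHS](expRxMexpNx_1 x) mulrC ler_wpM2l // ltW.
have x1 : 0 < 1 - x by lra.
suff : (1 - x) * expR x <= (1 - x) * (1 + x + 2 * x ^+ 2) by rewrite ler_pM2l.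
apply: le_trans h1 _.
have : 0 <= x ^+ 2 * (1 - 2 * x) by rewrite mulr_ge0 ?sqr_ge0 //; lra.
rewrite !expr2; lra.
Qed.

(** The quadratic term keeps the factor p, the order of the variance of a rare edge. A bound by the
    range of the variable alone would lose it, and with it the tail estimate for sparse graphs. *)
Lemma bernoulli_mgf p d : 0 <= p -> p <= 1 -> d <= 1 / 2 ->
  p * expR d + (1 - p) <= expR (p * d + 2 * p * d ^+ 2).
Proof.
move=> p0 p1 d2; apply: le_trans (expR_ge1Dx _).
have := ler_wpM2l p0 (expR_quadratic d2); rewrite !expr2; lra.
Qed.
End ExponentialInequalities.

Section Concentration.
Context {R : realType} {T : finType}.
Variable p : R.
Hypotheses (p0 : 0 <= p) (p1 : p <= 1).
Implicit Types (A B U : {set T}) (f g : {set T} -> R) (l : seq T).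

Definition lipschitz_at (c : T -> R) f :=
  forall A B e, (A :\ e = B :\ e)%SET -> `|f A - f B| <= c e.

Let q0 : 0 <= 1 - p. Proof. by rewrite subr_ge0. Qed.

Lemma lipschitz_avgs c l f : lipschitz_at c f -> lipschitz_at c (avgs p l f).
Proof.
elim: l => //= x l IH /IH{}IH A B e AB; rewrite /avg.
have H1 : (x |: A) :\ e = (x |: B) :\ e by rewrite !setDUl AB.
have H0 : (A :\ x) :\ e = (B :\ x) :\ e by rewrite !setDDl setUC -!setDDl AB.
have h1 := ler_wpM2l p0 (IH _ _ _ H1); have h0 := ler_wpM2l q0 (IH _ _ _ H0).
set a1 := avgs p l f _ in h1 *; set b1 := avgs p l f _ in h1 *.
set a0 := avgs p l f _ in h0 *; set b0 := avgs p l f _ in h0 *.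
have -> : p * a1 + (1 - p) * a0 - (p * b1 + (1 - p) * b0) =
  p * (a1 - b1) + (1 - p) * (a0 - b0) by ring.
apply: le_trans (ler_normD _ _) _; rewrite !normrM (ger0_norm p0) (ger0_norm q0).
lra.
Qed.

(** The martingale argument, one coordinate at a time: setting coordinate [e] moves the averaged
    function by at most [c e], and [bernoulli_mgf] bounds the exponential moment of that single
    step. *)
Lemma avgs_mgf c l f lam A : 0 <= lam -> lipschitz_at c f ->
  (forall e, lam * c e <= 1 / 2) ->
  avgs p l (fun B => expR (- lam * f B)) A <=
  expR (- lam * avgs p l f A + 2 * lam ^+ 2 * p * \sum_(e <- l) c e ^+ 2).
Proof.
move=> lam0 fL c2; elim: l A => [|e l IH] A /=.
  by rewrite big_nil mulr0 addr0.
rewrite /avg big_cons; set V := \sum_(j <- l) _.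
have := IH (e |: A)%SET; have := IH (A :\ e)%SET.
set x1 := avgs p l _ (e |: A)%SET; set x0 := avgs p l _ (A :\ e)%SET.
have := @lipschitz_avgs c l f fL (e |: A)%SET (A :\ e)%SET e.
have -> : ((e |: A) :\ e = (A :\ e) :\ e)%SET.
  by rewrite setDUl setDv set0U setDDl setUid.
move=> /(_ erefl).
set a1 := avgs p l f (e |: A)%SET; set a0 := avgs p l f (A :\ e)%SET => ha h0 h1.
pose d := - lam * (a1 - a0).
have d2 : `|d| <= lam * c e by rewrite normrM normrN (ger0_norm lam0) ler_wpM2l.
have dd : d ^+ 2 <= lam ^+ 2 * c e ^+ 2.
  by rewrite -exprMn -real_normK ?num_real // lerXn2r ?nnegrE // (le_trans _ d2).
have d3 : d <= 1 / 2 by apply: le_trans (ler_norm _) (le_trans d2 _).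
set W := 2 * lam ^+ 2 * p * V in h0 h1 *.
have M1 := ler_wpM2l p0 h1; have M0 := ler_wpM2l q0 h0.
apply: (@le_trans _ _ (expR (- lam * a0 + W) * (p * expR d + (1 - p)))).
  have -> : expR (- lam * a0 + W) * (p * expR d + (1 - p)) =
    p * expR (- lam * a1 + W) + (1 - p) * expR (- lam * a0 + W).
    rewrite mulrDr mulrCA -expRD [X in _ + X]mulrC; congr (p * expR _ + _).
    by rewrite /d; ring.
  by apply: lerD.
have := bernoulli_mgf p0 p1 d3.
move=> /(ler_wpM2l (ltW (expR_gt0 (- lam * a0 + W)))) /le_trans; apply.
rewrite -expRD ler_expR.
have := ler_wpM2l p0 dd; rewrite /W /d => Hd.
have -> : - lam * (p * a1 + (1 - p) * a0) + 2 * lam ^+ 2 * p * (c e ^+ 2 + V) =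
  - lam * a0 + W + (p * d + 2 * (p * (lam ^+ 2 * c e ^+ 2))).
  by rewrite /W /d; ring.
by rewrite lerD2l lerD2l -mulrA ler_wpM2l.
Qed.

Lemma lower_tail c f lam x y : 0 <= lam -> lipschitz_at c f ->
  (forall e, lam * c e <= 1 / 2) -> y <= expect p f ->
  prob p (fun A => f A <= x) <=
  expR (lam * x - lam * y + 2 * lam ^+ 2 * p * \sum_e c e ^+ 2).
Proof.
move=> lam0 fL c2 yE.
apply: le_trans (prob_markov p0 p1 (f := fun A => expR (lam * x + - lam * f A)) _ _) _.
- by move=> A; exact: expR_ge0.
- move=> A fx; rewrite -expR0 ler_expR mulNr subr_ge0.
  by rewrite ler_wpM2l.
under eq_expect => A do rewrite expRD.
rewrite expectZ -addrA expRD ler_wpM2l ?expR_ge0 // expect_avgs_enum //.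
apply: le_trans (avgs_mgf _ _ lam0 fL c2) _.
rewrite ler_expR -expect_avgs_enum // big_enum /= lerD2r !mulNr lerN2.
by rewrite ler_wpM2l.
Qed.

Variables (I : finType) (al : I -> {set T}).

Lemma incr_subset U : incr (fun A => (U \subset A)%:R : R).
Proof.
move=> A B AB; case: (boolP (U \subset A)) => UA; last exact: ler0n.
by rewrite (fintype.subset_trans UA AB).
Qed.

Lemma decr_avoid (r : seq I) :
  decr (fun A => (~~ has (fun i => al i \subset A) r)%:R : R).
Proof.
move=> A B AB; rewrite ler_nat; case: hasP => //= nB; case: hasP => //= -[i ir iA].
by case: nB; exists i => //; exact: fintype.subset_trans AB.
Qed.

Lemma depends_subset U : depends U (fun A => (U \subset A)%:R : R).
Proof.
move=> A B AB; congr (_ %:R); congr nat_of_bool.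
have E (C : {set T}) : (U \subset C) = (C :&: U == U) by rewrite setIC (sameP eqP setIidPl).
by rewrite !E AB.
Qed.

Let meet i j := (i != j) && (al i :&: al j != set0).

(* Boppana-Spencer argument; Harris' inequality is only needed unconditionally,
   in the form P(A_i A_j N1) <= P(A_i A_j) P(N1). *)
Lemma janson_seq (r : seq I) : uniq r ->
  prob p (fun A => ~~ has (fun i => al i \subset A) r) <=
  expR (- (\sum_(i <- r) p ^+ #|al i|) +
        \sum_(i <- r) \sum_(j <- r | meet i j) p ^+ #|al i :|: al j|).
Proof.
elim: r => [|i r IH] /=; first by rewrite !big_nil oppr0 add0r expR0 prob_le1.
case/andP=> ir /IH{}IH.
pose N A : R := (~~ has (fun i => al i \subset A) r)%:R.
pose r1 := [seq j <- r | al i :&: al j == set0].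
pose N1 A : R := (~~ has (fun i => al i \subset A) r1)%:R.
pose a j A : R := (al j \subset A)%:R.
set s := \sum_(j <- r | meet i j) p ^+ #|al i :|: al j|.
have NN1 A : N A <= N1 A.
  rewrite ler_nat; case: hasP => //= h; case: hasP => //= -[j].
  by rewrite mem_filter => /andP[_ jr] jA; case: h; exists j.
(* If some [al j] lies in [A] although [N1 A = 1], then [j] was filtered out of [r1], hence meets
   [i], and its summand already cancels [N1 A]. *)
have N0 A : N1 A - \sum_(j <- r | meet i j) a j A * N1 A <= N A.
  rewrite /N; case: hasP => [[j jr jA]|_] /=; last first.
    have : 0 <= \sum_(j <- r | meet i j) a j A * N1 A.
      by apply: sumr_ge0 => j _; rewrite mulr_ge0 /a /N1 ?ler0n.
    have : N1 A <= 1 by rewrite /N1 lern1 leq_b1.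
    lra.
  rewrite subr_le0; case: (boolP (meet i j)) => mij.
    rewrite (big_rem _ jr) /= mij {1}/a jA mul1r lerDl.
    by apply: sumr_ge0 => j' _; rewrite mulr_ge0 /a /N1 ?ler0n.
  have -> : N1 A = 0.
    rewrite /N1; case: hasP => //= -[]; exists j => //; rewrite mem_filter jr andbT.
    apply: contraNT mij => h; rewrite /meet h andbT.
    by apply: contraNneq ir => ->.
  by apply: sumr_ge0 => j' _; rewrite mulr0.
have E1 : expect p (fun A => a i A * N1 A) = p ^+ #|al i| * expect p N1.
  rewrite (@expect_indep _ _ _ (al i)) ?expect_subset //; first exact: depends_subset.
  move=> A B AB; rewrite /N1; congr (_ %:R); congr nat_of_bool; congr negb.
  apply: eq_in_has => j; rewrite mem_filter => /andP[ij _].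
  have E (C : {set T}) : (al j \subset C) = (al j \subset C :&: ~: al i).
    by rewrite subsetI -disjoints_subset disjoint_sym -setI_eq0 ij andbT.
  by rewrite (E A) (E B) AB.
have E2 j : expect p (fun A => a i A * (a j A * N1 A)) <=
    p ^+ #|al i :|: al j| * expect p N1.
  have -> : expect p (fun A => a i A * (a j A * N1 A)) =
      expect p (fun A => (al i :|: al j \subset A)%:R * N1 A).
    by apply: eq_expect => A; rewrite mulrA /a subUset -natrM mulnb.
  rewrite -(expect_subset p); apply: harris => //; last exact: decr_avoid.
  exact: incr_subset.
have E3 : (p ^+ #|al i| - s) * expect p N1 <= expect p (fun A => a i A * N A).
  apply: le_trans (ler_expect p0 p1
    (f := fun A => a i A * (N1 A - \sum_(j <- r | meet i j) a j A * N1 A)) _).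
    have -> : expect p (fun A => a i A * (N1 A - \sum_(j <- r | meet i j) a j A * N1 A)) =
        p ^+ #|al i| * expect p N1 -
        \sum_(j <- r | meet i j) expect p (fun A => a i A * (a j A * N1 A)).
      rewrite -E1 -expect_sum -[X in _ - X]mul1r -mulNr -expectZ -expectD.
      by apply: eq_expect => A; rewrite mulrBr mulr_sumr mulN1r.
    rewrite mulrBl lerD2l lerN2 /s mulr_suml.
    by apply: ler_sum => j _; exact: E2.
  by move=> A; rewrite ler_wpM2l // /a ler0n.
have E4 : prob p (fun A => ~~ has (fun i => al i \subset A) (i :: r)) =
    expect p N - expect p (fun A => a i A * N A).
  rewrite -[X in _ - X]mul1r -mulNr -expectZ -expectD; apply: eq_expect => A.
  by rewrite /= negb_or /N /a; case: (al i \subset A) => /=; rewrite ?mul0r; ring.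
rewrite E4 big_cons [X in - _ + X]big_cons.
have mii : meet i i = false by rewrite /meet eqxx.
have sm0 j (P : pred I) : 0 <= \sum_(k <- r | P k) p ^+ #|al j :|: al k|.
  by apply: sumr_ge0 => k _; exact: exprn_ge0.
have Hs : s + \sum_(j <- r) \sum_(k <- r | meet j k) p ^+ #|al j :|: al k| <=
   \sum_(j <- i :: r | meet i j) p ^+ #|al i :|: al j| +
   \sum_(j <- r) \sum_(k <- i :: r | meet j k) p ^+ #|al j :|: al k|.
  apply: lerD; first by rewrite big_cons mii.
  apply: ler_sum => j _; rewrite big_cons; case: ifP => // _.
  by rewrite lerDr exprn_ge0.
set rr := p ^+ #|al i| - s in E3 *.
apply: (@le_trans _ _ (expR (- rr) * expect p N)).
  have EN : 0 <= expect p N by apply: expect_ge0 => // A; exact: ler0n.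
  have EN1 : expect p N <= expect p N1 by exact: ler_expect.
  have EaN : 0 <= expect p (fun A => a i A * N A).
    by apply: expect_ge0 => // A; rewrite mulr_ge0 /a /N ?ler0n.
  have h := expR_ge1Dx (- rr).
  have h' := ler_wpM2r EN h.
  (* For rr > 0, E[N] <= E[N1] turns the loss rr E[N1] into at least rr E[N], and 1 - rr <= e^(-rr).
     For rr <= 0 the factor e^(-rr) is at least 1. *)
  case: (lerP rr 0) => r0.
    have : (1 - rr) * expect p N >= expect p N by rewrite ler_peMl //; lra.
    lra.
  have := ler_wpM2l (ltW r0) EN1; lra.
apply: (le_trans (ler_wpM2l (expR_ge0 _) IH)); rewrite -expRD ler_expR /rr.
lra.
Qed.

(* The exponent of [janson_seq] applied to a random q-subset of [F] has this
   mean, so some subset does at least as well. *)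
Lemma janson_sampling (F : {set I}) (q mu Delta : R) : 0 <= q -> q <= 1 ->
  mu = \sum_(i in F) p ^+ #|al i| ->
  \sum_(i in F) \sum_(j in F | meet i j) p ^+ #|al i :|: al j| <= Delta ->
  prob p (fun A => ~~ [exists i in F, al i \subset A]) <=
  expR (- (q * mu) + q ^+ 2 * Delta).
Proof.
move=> q0' q1 -> hD; set P := prob p _.
(* The averaging takes place inside the logarithm of [P], so [P] must be positive. *)
case: (lerP P 0) => [/le_trans|P0]; first by apply; exact: expR_ge0.
pose g (F' : {set I}) : R := \sum_(i in F) (i \in F')%:R * - p ^+ #|al i| +
  \sum_(i in F) \sum_(j in F | meet i j)
     ([set i; j] \subset F')%:R * p ^+ #|al i :|: al j|.
have lnP F' : ln P <= g F'.
  rewrite -ler_expR lnK ?posrE //.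
  apply: le_trans (le_trans (janson_seq (enum_uniq (mem (F :&: F')))) _).
    apply: prob_sub => // A; apply: contra => /hasP[i].
    rewrite mem_enum inE => /andP[iF _] iA; by apply/existsP; exists i; rewrite iF.
  rewrite ler_expR /g big_enum /= [X in _ + X <= _]big_enum /=.
  have E1 : - (\sum_(i in F :&: F') p ^+ #|al i|) =
      \sum_(i in F) (i \in F')%:R * - p ^+ #|al i|.
    rewrite -sumrN (eq_bigl _ _ (fun i => finset.in_setI i F F')) big_mkcondr /=.
    apply: eq_bigr => i _.
    by case: ifP => _; rewrite ?mul1r ?mul0r.
  rewrite E1 lerD2l (eq_bigl _ _ (fun i => finset.in_setI i F F')) big_mkcondr /=.
  apply: ler_sum => i _.
  case: ifP => iF'; last first.
    by apply: sumr_ge0 => j _; rewrite mulr_ge0 ?ler0n ?exprn_ge0.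
  rewrite big_enum_cond /= big_mkcond [leRHS]big_mkcond; apply: ler_sum => j _.
  rewrite inE subUset !sub1set iF' /=.
  by case: (j \in F); case: (j \in F'); case: (meet i j);
    rewrite /= ?mul1r ?mul0r ?exprn_ge0.
rewrite -[leLHS](lnK (x := P)) ?posrE // ler_expR.
have e1 : expect q (fun F' => (\sum_(i in F) (i \in F')%:R * - p ^+ #|al i| : R)) =
    - (q * \sum_(i in F) p ^+ #|al i|).
  rewrite expect_sum mulr_sumr -sumrN; apply: eq_bigr => i _.
  under eq_expect => F' do rewrite mulrC -sub1set.
  by rewrite expectZ expect_subset cards1 expr1; ring.
have e2 : expect q (fun F' => (\sum_(i in F) \sum_(j in F | meet i j)
     ([set i; j] \subset F')%:R * p ^+ #|al i :|: al j| : R)) =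
    q ^+ 2 * \sum_(i in F) \sum_(j in F | meet i j) p ^+ #|al i :|: al j|.
  rewrite expect_sum mulr_sumr; apply: eq_bigr => i _.
  rewrite expect_sum mulr_sumr; apply: eq_bigr => j /andP[_ /andP[ij _]].
  under eq_expect => F' do rewrite mulrC.
  by rewrite expectZ expect_subset cards2 ij mulrC.
apply: (@le_trans _ _ (expect q g)).
  by rewrite -[leLHS](expect_cst (T := I) q); exact: ler_expect.
rewrite /g expectD e1 e2 lerD2l.
by rewrite ler_wpM2l // exprn_ge0.
Qed.

(** [Rb] bounds the correlation sum relative to each single probability, so the sampling exponent is
    -q mu + q^2 Rb mu, minimal at q = 1/(2 Rb). *)
Lemma janson (F : {set I}) (mu Rb : R) : 1 <= Rb ->
  mu = \sum_(i in F) p ^+ #|al i| ->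
  (forall i, i \in F ->
    p ^+ #|al i| + \sum_(j in F | meet i j) p ^+ #|al i :|: al j| <= Rb * p ^+ #|al i|) ->
  prob p (fun A => ~~ [exists i in F, al i \subset A]) <= expR (- (mu / (4 * Rb))).
Proof.
move=> Rb1 E H.
have Rb0 : 0 < Rb by lra.
have mu0 : 0 <= mu by rewrite E sumr_ge0 // => i _; exact: exprn_ge0.
have H' : \sum_(i in F) \sum_(j in F | meet i j) p ^+ #|al i :|: al j| <= Rb * mu.
  rewrite E mulr_sumr; apply: ler_sum => i iF; apply: le_trans (H i iF).
  by rewrite lerDr exprn_ge0.
apply: le_trans (janson_sampling (q := (2 * Rb)^-1) _ _ E H') _.
- by rewrite invr_ge0; lra.
- by rewrite invf_le1; lra.
rewrite ler_expR; rewrite le_eqVlt; apply/orP; left; apply/eqP; field; lra.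
Qed.

End Concentration.

(** * Cliques, common neighbours and colour classes *)

Section Truncation.
Context {V : finType}.
Implicit Types (A B : {set V}).

(** For [x] in [A] the count includes [x], so ranks start at 1 and [rank_in A x <= M] selects
    exactly the first [M] elements. *)
Definition rank_in A (x : V) : nat := #|[set y in A | (enum_rank y <= enum_rank x)%N]|.
Definition trunc (M : nat) A := [set x in A | (rank_in A x <= M)%N].

Lemma rank_in_lt A x y : y \in A -> (enum_rank x < enum_rank y)%N ->
  (rank_in A x < rank_in A y)%N.
Proof.
move=> yA xy; apply: proper_card; apply/properP; split.
  apply/fintype.subsetP => z; rewrite !inE => /andP[-> /= zx].
  exact: ltnW (leq_ltn_trans zx xy).
by exists y; rewrite !inE yA ?leqnn // -ltnNge.
Qed.

Lemma rank_inS A B x : A \subset B -> (rank_in A x <= rank_in B x)%N.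
Proof.
move=> AB; apply: subset_leq_card; apply/fintype.subsetP => z; rewrite !inE.
by case/andP => /(fintype.subsetP AB) -> ->.
Qed.

Lemma rank_inU1 A u x : (rank_in (u |: A) x <= (rank_in A x).+1)%N.
Proof.
rewrite -add1n -(cards1 u); apply: leq_trans (leq_card_setU _ _).
apply: subset_leq_card; apply/fintype.subsetP => z; rewrite !inE.
by case: eqVneq.
Qed.

Lemma truncS M A : trunc M A \subset A.
Proof. by apply/fintype.subsetP => x; rewrite inE => /andP[]. Qed.

Lemma trunc_id M A : (#|A| <= M)%N -> trunc M A = A.
Proof.
move=> AM; apply/setP => x; rewrite inE; case: (x \in A) => //=.
apply: leq_trans AM; apply: subset_leq_card.
by apply/fintype.subsetP => z; rewrite inE => /andP[].
Qed.

Lemma card_trunc M A : (#|trunc M A| <= M)%N.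
Proof.
case: (set_0Vmem (trunc M A)) => [->|[x0 x0A]]; first by rewrite cards0.
case: (arg_maxnP (fun x => nat_of_ord (enum_rank x)) x0A) => x xA xmax.
have : x \in trunc M A by []; rewrite inE => /andP[_]; apply: leq_trans.
apply: subset_leq_card; apply/fintype.subsetP => z zA; rewrite inE.
by rewrite (fintype.subsetP (truncS M A)) //; exact: xmax.
Qed.

(** Ranks are monotone in the set. If [A \subset B], only [u] itself can enter the truncation.
    Otherwise [A] is [B] with [u] added, an entering element has rank exactly [M] in [B], and only
    one element has that rank. *)
Lemma trunc_diff M A B u : (A :\ u = B :\ u)%SET ->
  (#|trunc M B :\: trunc M A| <= 1)%N.
Proof.
move=> AB; have ABz z : z != u -> (z \in A) = (z \in B).
  by move=> zu; move/setP/(_ z): AB; rewrite !inE zu.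
have T z : z \in trunc M B :\: trunc M A ->
    [/\ z \in B, (rank_in B z <= M)%N & (z \in A) ==> (M < rank_in A z)%N].
  rewrite !inE ltnNge => /andP[+ /andP[-> ->]]; by case: (z \in A).
apply/card_le1_eqP => x y /T[xB xM xA] /T[yB yM yA].
case: (boolP (A \subset B)) => [AsB|AnB].
  have notA z : (rank_in B z <= M)%N -> (z \in A) ==> (M < rank_in A z)%N -> z \notin A.
    move=> zM; case: (z \in A) => //=; by rewrite ltnNge (leq_trans (rank_inS z AsB)).
  have isu z : z \in B -> z \notin A -> z = u.
    by move=> zB zA; apply: contraTeq zB => zu; rewrite -ABz.
  by rewrite (isu x xB (notA x xM xA)) (isu y yB (notA y yM yA)).
have [uA uB] : u \in A /\ u \notin B.
  case/subsetPn: AnB => z zA zB; suff <- : z = u by [].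
  by apply: contraTeq zA => zu; rewrite ABz.
have EA : A = (u |: B)%SET.
  apply/setP => z; rewrite !inE; case: eqVneq => [->|zu] //=; exact: ABz.
have sB z : z \in B -> (z \in A) ==> (M < rank_in A z)%N -> (M <= rank_in B z)%N.
  move=> zB; rewrite EA !inE zB orbT /= => h.
  by rewrite -ltnS (leq_trans h) // rank_inU1.
have lt z t : z \in B -> t \in B -> (z \in A) ==> (M < rank_in A z)%N ->
    (rank_in B t <= M)%N -> ~~ (enum_rank z < enum_rank t)%N.
  move=> zB tB zA tM; apply/negP => /(rank_in_lt tB) h.
  by have := leq_trans (leq_ltn_trans (sB z zB zA) h) tM; rewrite ltnn.
apply: enum_rank_inj; apply: val_inj; apply/eqP; rewrite eqn_leq.
by rewrite [X in X && _]leqNgt [X in _ && X]leqNgt !lt.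
Qed.

(** The case k = 0 is split off because [k.-1] would turn an empty family into one of size 1. *)
Lemma card_draws_at A y k : y \in A ->
  #|[set K : {set V} | [&& K \subset A, #|K| == k & y \in K]]| = 'C(#|A|.-1, k.-1) \/ k = 0%N.
Proof.
move=> yA; case: k => [|k]; [by right|left].
have -> : [set K : {set V} | [&& K \subset A, #|K| == k.+1 & y \in K]] =
    [set (y |: K)%SET | K in [set K : {set V} | K \subset A :\ y & #|K| == k]].
  apply/setP => K; rewrite inE; apply/idP/imsetP.
    case/and3P=> KA /eqP Kk yK; exists (K :\ y)%SET; last by rewrite finset.setD1K.
    rewrite inE setSD //=; move: Kk; rewrite (cardsD1 y K) yK add1n => -[->] //=.
  case=> K'; rewrite inE subsetD1 => /andP[/andP[KA yK] /eqP Kk] ->.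
  by rewrite finset.setU11 cardsU1 yK Kk subUset sub1set yA KA eqxx.
rewrite card_in_imset ?cards_draws; first by rewrite (cardsD1 y A) yA.
move=> K1 K2; rewrite !inE !subsetD1 => /andP[/andP[_ y1] _] /andP[/andP[_ y2] _].
by move=> /(congr1 (fun K => K :\ y)%SET); rewrite !setU1K.
Qed.
End Truncation.

Section GraphEvents.
Context {V : finType}.
Implicit Types (G : graph V) (S K B : {set V}).

Definition nbr G v := [set u | adj G u v].
Definition star v K : {set vpair V} :=
  [set e : vpair V | [exists u in K, val e == [set u; v]%SET]].
Definition inner K : {set vpair V} := [set e : vpair V | val e \subset K].
Definition cross S : {set vpair V} := \bigcup_(v in ~: S) star v S.

Lemma pair_card2 (u v : V) : u != v -> #|[set u; v]%SET| == 2.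
Proof. by move=> uv; rewrite cards2 uv. Qed.

Definition edge (u v : V) (uv : u != v) : vpair V :=
  exist (fun A : {set V} => is_true (#|A| == 2)) [set u; v]%SET (pair_card2 uv).

Lemma adjE G u v (uv : u != v) : adj G u v = (edge uv \in G).
Proof.
rewrite /adj; apply/imsetP/idP => [[e eG E]|H]; last by exists (edge uv).
by rewrite (_ : edge uv = e) //; apply: val_inj.
Qed.

Lemma adj_neq G u v : adj G u v -> u != v.
Proof.
move=> /imsetP[e _ E]; have := valP e; rewrite -E; apply: contraTneq => ->.
by rewrite finset.setUid cards1.
Qed.

Lemma star_subset G v K : v \notin K -> (K \subset nbr G v) = (star v K \subset G).
Proof.
move=> vK; apply/fintype.subsetP/fintype.subsetP => H.
  move=> e; rewrite inE => /exists_inP[u uK /eqP E].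
  move: (H u uK); rewrite inE => /imsetP[e' e'G]; rewrite -E => /val_inj ->.
  exact: e'G.
move=> u uK; rewrite inE.
have uv : u != v by apply: contraNneq vK => <-.
by rewrite (adjE _ uv) H // inE; apply/exists_inP; exists u.
Qed.

Lemma pairR_inj (v u u' : V) : u != v -> [set u; v]%SET = [set u'; v]%SET -> u = u'.
Proof.
by move=> uv /setP/(_ u); rewrite !inE eqxx (negbTE uv) !orbF => /esym/eqP.
Qed.

Lemma card_star v K : v \notin K -> #|star v K| = #|K|.
Proof.
move=> vK; rewrite -(card_imset _ val_inj).
have -> : [set val e | e in star v K] = [set [set u; v]%SET | u in K].
  apply/setP => A; apply/imsetP/imsetP.
    by case=> e; rewrite inE => /exists_inP[u uK /eqP E] ->; exists u.
  case=> u uK ->; have uv : u != v by apply: contraNneq vK => <-.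
  exists (edge uv) => //; rewrite inE; apply/exists_inP.
  by exists u.
rewrite card_in_imset // => u u' uK u'K; apply: pairR_inj.
by apply: contraNneq vK => <-.
Qed.

Lemma inner_clique G K : clique G K = (inner K \subset G).
Proof.
apply/forall_inP/fintype.subsetP => H.
  move=> e; rewrite inE => eK; have /cards2P[x [y [xy E]]] := valP e.
  have /H/forall_inP/(_ y) : x \in K by rewrite (fintype.subsetP eK) // E !inE eqxx.
  rewrite xy /= => h; have /h : y \in K.
    by rewrite (fintype.subsetP eK) // E !inE eqxx orbT.
  by move=> /imsetP[e' e'G]; rewrite -E => /val_inj ->.
move=> x xK; apply/forall_inP => y yK; apply/implyP => xy.
by rewrite (adjE _ xy) H // in_set /= subUset !sub1set xK yK.
Qed.

Lemma card_inner K : #|inner K| = 'C(#|K|, 2).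
Proof.
rewrite -(card_imset _ val_inj) -cards_draws.
have -> // : [set val e | e in inner K] = [set A : {set V} | A \subset K & #|A| == 2].
apply/setP => A; rewrite [RHS]in_set; apply/imsetP/andP => [[e]|[AK A2]].
  by rewrite in_set => eK ->; split => //; case: (e).
by exists (exist (fun A : {set V} => is_true (#|A| == 2)) A A2); rewrite ?in_set.
Qed.

Lemma innerI K K' : (inner K :&: inner K' = inner (K :&: K'))%SET.
Proof. by apply/setP => e; rewrite !inE subsetI. Qed.

Lemma star_disjoint S v w : v \notin S -> w \notin S -> v != w ->
  [disjoint star v S & star w S].
Proof.
move=> vS wS vw; apply/pred0P => e /=; apply/negbTE/negP; rewrite !inE.
case/andP=> /exists_inP[u uS /eqP ->] /exists_inP[u' u'S /eqP] /setP/(_ v).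
rewrite !inE eqxx orbT (negbTE vw) orbF => /esym/eqP E.
by rewrite E u'S in vS.
Qed.

Lemma star_inner S v : v \notin S -> [disjoint star v S & inner S].
Proof.
move=> vS; apply/pred0P => e /=; apply/negbTE/negP; rewrite !inE.
case/andP=> /exists_inP[u uS /eqP ->]; rewrite subUset !sub1set.
by rewrite (negbTE vS) andbF.
Qed.

Lemma cross_inner S : [disjoint cross S & inner S].
Proof.
rewrite disjoint_sym; apply/bigcup_disjointP => v; rewrite inE => vS.
by rewrite disjoint_sym star_inner.
Qed.

Lemma card_cross S : (#|cross S| <= #|S| * #|V|)%N.
Proof.
apply: (@leq_trans (\sum_(v in ~: S) #|star v S|)); last first.
  rewrite (eq_bigr (fun=> #|S|)); last by move=> v; rewrite inE => /card_star.
  by rewrite sum_nat_const mulnC leq_mul2l max_card orbT.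
rewrite /cross; elim/big_ind2: _ => [|m A m' A' h h'|v _] //; first by rewrite cards0.
exact: leq_trans (leq_card_setU _ _) (leq_add h h').
Qed.

Lemma nbr_depends S v G G' : v \notin S ->
  G :&: star v S = G' :&: star v S -> (nbr G v :&: S = nbr G' v :&: S)%SET.
Proof.
move=> vS E; apply/setP => u; rewrite !inE.
case: (boolP (u \in S)) => uS; rewrite ?andbF ?andbT //.
have uv : u != v by apply: contraNneq vS => <-.
rewrite !(adjE _ uv); move/setP/(_ (edge uv)): E; rewrite !inE.
suff -> : [exists u0 in S, val (edge uv) == [set u0; v]%SET].
  by rewrite !andbT.
by apply/exists_inP; exists u.
Qed.

Lemma subset_nbr_depends S v K G G' : v \notin S -> K \subset S ->
  G :&: star v S = G' :&: star v S -> (K \subset nbr G v) = (K \subset nbr G' v).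
Proof.
move=> vS KS E.
have H (X : {set V}) : (K \subset X) = (K \subset X :&: S) by rewrite subsetI KS andbT.
by rewrite H (nbr_depends vS E) -H.
Qed.

Lemma coloring_class G q s k : clique_colorable G q -> (q * s.-1 < #|V|)%N ->
  (1 < k)%N -> (0 < s)%N ->
  exists2 S : {set V}, #|S| = s & forall K, K \subset S -> #|K| = k ->
    clique G K -> exists2 v, v \notin S & K \subset nbr G v.
Proof.
move=> /existsP[c cc] qs k1 s0.
have [i hi] : exists i : 'I_q, (s <= #|[set x | c x == i]|)%N.
  apply/existsP; rewrite -[X in is_true X]negbK negb_exists; apply/negP => /forallP H.
  suff : (#|V| <= q * s.-1)%N by rewrite leqNgt qs.
  rewrite -sum1_card (partition_big c predT) //=.
  rewrite -[in leqRHS](card_ord q) -sum_nat_const; apply: leq_sum => i _.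
  rewrite sum1_card -ltnS prednK // ltnNge.
  by move: (H i); rewrite cardsE.
have [S Si Ss] : exists2 S : {set V}, S \subset [set x | c x == i] & #|S| = s.
  have := cards_draws [set x | c x == i] s.
  have : (0 < 'C(#|[set x | c x == i]|, s))%N by rewrite bin_gt0.
  move=> + E; rewrite -E card_gt0 => /set0Pn[S]; rewrite inE => /andP[h /eqP h'].
  by exists S.
exists S => // K KS Kk Kc; apply/exists_inP; rewrite -[X in is_true X]negbK.
rewrite negb_exists_in; apply/negP => /forall_inP H.
have [Mx Mmax KM] := maxset_exists Kc.
have MS : Mx \subset S.
  apply/fintype.subsetP => v vM; apply: contraT => vS.
  have /negP[] := H v vS; apply/fintype.subsetP => u uK; rewrite inE.
  have /forall_inP/(_ u)/= := maxsetp Mmax => /(_ (fintype.subsetP KM _ uK)).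
  move/forall_inP/(_ v vM)/implyP; apply.
  by apply: contraNneq vS => <-; exact: (fintype.subsetP KS).
move/forallP/(_ Mx): cc; rewrite /maximal_clique Mmax /=.
(* k >= 2 ensures that the maximal clique is not one of the exempt cliques with at most one
   vertex. *)
have -> : (1 < #|Mx|)%N by rewrite (leq_trans k1) // -Kk subset_leq_card.
move=> /negP[]; apply/forall_inP => x xM; apply/forall_inP => y yM.
have := fintype.subsetP Si x (fintype.subsetP MS x xM).
have := fintype.subsetP Si y (fintype.subsetP MS y yM).
by rewrite !inE => /eqP -> /eqP ->.
Qed.

End GraphEvents.

(** * Cliques without outside common neighbour *)

Section GraphProbabilities.
Context {R : realType} {V : finType}.
Variable p : R.
Hypotheses (p0 : 0 <= p) (p1 : p <= 1).
Implicit Types (G : graph V) (S K B : {set V}) (H : {set {set V}}).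

Definition ksets k S : {set {set V}} := [set K : {set V} | K \subset S & #|K| == k].

Definition uncovered k S B G : {set {set V}} :=
  [set K in ksets k S | [forall v in B, ~~ (K \subset nbr G v)]].

(** If [B] contains every outside vertex with more than [M] neighbours in [S], truncation changes
    nothing and the survivors of [uncovered k S B G] lie in [uncovered k S (~: S) G]. For a fixed
    [B] the definition makes sense on every graph, which gives a deterministic Lipschitz bound. *)
Definition survivors M S B (H : {set {set V}}) G : {set {set V}} :=
  [set K in H | [forall v in ~: (S :|: B), ~~ (K \subset trunc M (nbr G v :&: S))]].

(** An edge from [v0] to [S] affects only the neighbourhood of [v0], whose truncation gains at most
    one element [y]. A k-set that is lost must contain [y] and lie in a truncated set of at most [M]
    elements. *)
Lemma survivors_diff M S B H G G' k (e : vpair V) : (0 < k)%N ->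
  H \subset ksets k S -> (G :\ e = G' :\ e)%SET ->
  (#|survivors M S B H G :\: survivors M S B H G'| <=
   (e \in cross S) * 'C(M.-1, k.-1))%N.
Proof.
move=> k0 HS GG.
have same v : v \notin S -> e \notin star v S -> (nbr G v :&: S = nbr G' v :&: S)%SET.
  move=> vS ev; apply: (nbr_depends vS); apply/setP => x; move/setP/(_ x): GG.
  rewrite !in_setI !in_setD1; case: eqVneq => [-> _|_ /= -> //].
  by rewrite (negbTE ev) !andbF.
pose bad v := [set K in ksets k S | (K \subset trunc M (nbr G' v :&: S)) &&
  ~~ (K \subset trunc M (nbr G v :&: S))].
have sub : survivors M S B H G :\: survivors M S B H G' \subset
    \bigcup_(v in ~: S) bad v.
  apply/fintype.subsetP => K; rewrite !inE => /andP[+ /andP[KH /forall_inP h]].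
  rewrite KH /= negb_forall_in => /exists_inP[v]; rewrite inE => vSB.
  rewrite negbK => Kv; apply/bigcupP; exists v.
    by move: vSB; rewrite !inE negb_or => /andP[].
  by rewrite inE (fintype.subsetP HS _ KH) Kv h // inE.
apply: leq_trans (subset_leq_card sub) _.
have bad0 v : v \notin S -> e \notin star v S -> bad v = set0.
  by move=> vS ev; apply/setP => K; rewrite !inE (same _ vS ev) andbN andbF.
case: (boolP (e \in cross S)) => [/bigcupP[v0]|ncr]; last first.
  rewrite big1 ?cards0 // => v vS; apply: bad0; first by rewrite inE in vS.
  by apply: contra ncr => ev; apply/bigcupP; exists v.
rewrite inE => v0S ev0; rewrite mul1n.
rewrite (bigD1 v0) ?inE //= big1 => [|v /andP[]]; last first.
  rewrite inE => vS vv0; apply: bad0 => //.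
  by have := disjointFl (star_disjoint vS v0S vv0) ev0 => ->.
rewrite finset.setU0.
have [u uS ue] : exists2 u, u \in S & val e = [set u; v0]%SET.
  by move: ev0; rewrite inE => /exists_inP[u uS /eqP]; exists u.
have NN : ((nbr G v0 :&: S) :\ u = (nbr G' v0 :&: S) :\ u)%SET.
  apply/setP => x; rewrite !inE; case: eqVneq => //= xu.
  case: (boolP (x \in S)) => xS; rewrite ?andbF ?andbT //.
  have xv : x != v0 by apply: contraNneq v0S => <-.
  rewrite !(adjE _ xv); move/setP/(_ (edge xv)): GG; rewrite !inE.
  suff -> : edge xv != e by [].
  rewrite -val_eqE /= ue; apply: contra_neq xu => /pairR_inj; exact.
have := trunc_diff M NN; set T1 := trunc M (nbr G' v0 :&: S).
set T0 := trunc M (nbr G v0 :&: S) => c1.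
case: (set_0Vmem (T1 :\: T0)) => [E|[y yT]].
  suff -> : bad v0 = set0 by rewrite cards0.
  apply/setP => K; rewrite !inE -/T0 -/T1; apply/negbTE/negP => /and3P[_ K1 /negP[]].
  by apply: (fintype.subset_trans K1); rewrite -setD_eq0 E.
have Ey z : z \in T1 -> z \notin T0 -> z = y.
  by move=> z1 z0; apply: (card_le1_eqP c1) => //; rewrite inE z0.
apply: (@leq_trans #|[set K : {set V} | [&& K \subset T1, #|K| == k & y \in K]]|).
  apply: subset_leq_card; apply/fintype.subsetP => K; rewrite !inE -/T0 -/T1.
  case/and3P=> /andP[_ ->] K1; rewrite K1 /= => /subsetPn[z zK z0].
  by rewrite -(Ey z) // (fintype.subsetP K1).
have yT1 : y \in T1 by move: yT; rewrite inE => /andP[].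
case: (card_draws_at k yT1) => [->|k00]; last by rewrite k00 in k0.
apply: leq_bin2l; have := card_trunc M (nbr G' v0 :&: S); rewrite -/T1; lia.
Qed.

Lemma survivors_lipschitz M S B H k : (0 < k)%N -> H \subset ksets k S ->
  lipschitz_at (fun e => (e \in cross S)%:R * 'C(M.-1, k.-1)%:R)
    (fun G => #|survivors M S B H G|%:R : R).
Proof.
move=> k0 HS.
have one G G' e : (G :\ e = G' :\ e)%SET -> (#|survivors M S B H G|%:R : R) <=
    #|survivors M S B H G'|%:R + (e \in cross S)%:R * 'C(M.-1, k.-1)%:R.
  move=> GG; rewrite -natrM -natrD ler_nat.
  have := survivors_diff M B k0 HS GG.
  have := cardsID (survivors M S B H G') (survivors M S B H G).
  have := subset_leq_card (finset.subsetIr (survivors M S B H G) (survivors M S B H G')).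
  lia.
move=> G G' e GG; rewrite ler_norml; have := one _ _ _ GG.
have := one _ _ _ (esym GG); lra.
Qed.

(** Truncation only adds survivors, so it suffices that [K] escapes the full neighbourhoods of the
    vertices outside [S :|: B]. Each escape is a decreasing event of probability 1 - p^k; Harris'
    inequality multiplies them, and the exponent may be enlarged to [#|V|]. *)
Lemma expect_survivors M S B H k : H \subset ksets k S ->
  (1 - p ^+ k) ^+ #|V| * #|H|%:R <= expect p (fun G => #|survivors M S B H G|%:R).
Proof.
move=> HS.
have pk0 : 0 <= 1 - p ^+ k by rewrite subr_ge0 exprn_ile1.
have pk1 : 1 - p ^+ k <= 1 by rewrite lerBlDr lerDl exprn_ge0.
pose F v K G : R := (~~ (star v K \subset G))%:R.
have FE v K : v \notin S -> K \in H -> expect p (F v K) = 1 - p ^+ k.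
  move=> vS KH; move: (fintype.subsetP HS _ KH); rewrite inE => /andP[KS /eqP <-].
  have vK : v \notin K by apply: contra vS; exact: fintype.subsetP.
  rewrite -(card_star vK) -(expect_subset p) -[X in X - _](expect_cst (T := vpair V) p 1).
  rewrite -[X in _ - X]mul1r -mulNr -expectZ -expectD; apply: eq_expect => G.
  by rewrite /F; case: (star v K \subset G) => /=; ring.
apply: (@le_trans _ _ (\sum_(K in H) expect p (fun G => \prod_(v in ~: (S :|: B)) F v K G))).
  rewrite mulr_natr -sumr_const; apply: ler_sum => K KH.
  apply: le_trans (harris_decr_prod p0 p1 _ _ _ _); first last.
  - by move=> v G; rewrite /F ler0n.
  - move=> v G G' GG; rewrite ler_nat; case: (boolP (star v K \subset G')) => //= h.
    case: (boolP (star v K \subset G)) => //= h'.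
    by rewrite (fintype.subset_trans h' GG) in h.
  rewrite (eq_bigr (fun=> 1 - p ^+ k)); last first.
    by move=> v; rewrite inE => vSB; apply: FE => //; move: vSB; rewrite inE negb_or => /andP[].
  by rewrite prodr_const ler_wiXn2l // max_card.
rewrite -expect_sum; apply: ler_expect => // G.
rewrite -sum1_card natr_sum big_mkcond [leRHS]big_mkcond /=; apply: ler_sum => K _.
rewrite inE; case: (boolP (K \in H)) => KH //=.
case: (boolP [forall v in _, _]) => [_|].
  by apply: prodr_ile1 => v _; rewrite /F ler0n lern1 leq_b1.
rewrite negb_forall_in => /exists_inP[v vSB]; rewrite negbK => Kv.
have vS : v \notin S by move: vSB; rewrite !inE negb_or => /andP[].
rewrite (bigD1 v) //= /F; move: (fintype.subsetP HS _ KH); rewrite inE => /andP[KS _].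
rewrite -star_subset; last by apply: contra vS; exact: fintype.subsetP.
rewrite (fintype.subset_trans Kv) ?mul0r //.
exact: fintype.subset_trans (truncS _ _) (finset.subsetIl _ _).
Qed.

Lemma uncoveredS k S B G : uncovered k S B G \subset ksets k S.
Proof. by apply/fintype.subsetP => K; rewrite inE => /andP[]. Qed.

Lemma uncovered_depends k S B G G' : B \subset ~: S ->
  G :&: \bigcup_(v in B) star v S = G' :&: \bigcup_(v in B) star v S ->
  uncovered k S B G = uncovered k S B G'.
Proof.
move=> BS E; apply/setP => K; rewrite !inE; case: (boolP (K \subset S)) => //= KS.
congr (_ && _); apply/eq_forallb_in => v vB; congr negb.
have vS : v \notin S by have := fintype.subsetP BS v vB; rewrite inE.
apply: (subset_nbr_depends vS KS).
have sub : star v S \subset \bigcup_(v in B) star v S.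
    exact: (@finset.bigcup_sup _ _ v (mem B) (fun v => star v S)).
by rewrite -(setIidPr sub) !finset.setIA E.
Qed.

(** Freezing the edges between [B] and [S] fixes the family of uncovered sets; [lower_tail] then
    runs on the other edges. Only the at most |S||V| edges leaving [S] have a nonzero Lipschitz
    constant. *)
Lemma uncovered_survivors_tail S B k M (h x c lam : R) : (0 < k)%N ->
  B \subset ~: S -> 0 <= lam -> 'C(M.-1, k.-1)%:R <= c -> lam * c <= 1 / 2 ->
  prob p (fun G => (h <= #|uncovered k S B G|%:R) &&
                   (#|survivors M S B (uncovered k S B G) G|%:R <= x)) <=
  expR (lam * x - lam * ((1 - p ^+ k) ^+ #|V| * h) +
        2 * lam ^+ 2 * p * (#|S|%:R * #|V|%:R * c ^+ 2)).
Proof.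
move=> k0 BS lam0 cM lc.
have c0 : 0 <= c by apply: le_trans cM; exact: ler0n.
have pk0 : 0 <= 1 - p ^+ k by rewrite subr_ge0 exprn_ile1.
pose Y (H : {set {set V}}) G := #|survivors M S B (H :&: ksets k S) G|%:R <= x.
apply: le_trans (prob_freeze p0 p1 (U := \bigcup_(v in B) star v S)
  (X := uncovered k S B) 
  (Q := fun H => (H \subset ksets k S) && (h <= #|H|%:R)) (Y := Y) _ _ (expR_ge0 _) _).
- apply: prob_sub => // G /andP[hh sx].
  by rewrite uncoveredS hh /= /Y (setIidPl (uncoveredS _ _ _ _)).
- by move=> G G'; exact: uncovered_depends.
- move=> H G G' E; rewrite /Y.
  suff -> : survivors M S B (H :&: ksets k S) G = survivors M S B (H :&: ksets k S) G' by [].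
  apply/setP => K; rewrite !inE; congr (_ && _); apply/eq_forallb_in => v.
  rewrite !inE negb_or => /andP[vS vB]; congr (~~ (_ \subset trunc M _)).
  apply: nbr_depends => //.
  have sub : star v S \subset ~: \bigcup_(v in B) star v S.
    rewrite -disjoints_subset; apply/bigcup_disjointP => w wB.
    apply: star_disjoint => //; first by have := fintype.subsetP BS w wB; rewrite inE.
    by apply: contraNneq vB => ->.
  by rewrite -(setIidPr sub) !finset.setIA E.
move=> H /andP[HS hH].
have HH : H :&: ksets k S = H by exact/setIidPl.
rewrite /Y HH.
apply: le_trans (lower_tail p0 p1 x lam0 (@survivors_lipschitz M S B H k k0 HS) _
   (expect_survivors M B HS)) _.
  move=> e; apply: le_trans lc; rewrite ler_wpM2l //; apply: le_trans cM.
  by rewrite ler_piMl // lern1 leq_b1.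
rewrite ler_expR; apply: lerD.
  by rewrite lerD2l lerN2 !ler_wpM2l // exprn_ge0.
rewrite ler_wpM2l ?mulr_ge0 ?exprn_ge0 //.
apply: (@le_trans _ _ (\sum_(e in cross S) c ^+ 2)).
  rewrite [leRHS]big_mkcond; apply: ler_sum => e _.
  case: ifP => _; last by rewrite mul0r expr0n.
  by rewrite mul1r lerXn2r ?nnegrE.
rewrite sumr_const -[leLHS]mulr_natl ler_wpM2r ?exprn_ge0 // -natrM ler_nat.
exact: card_cross.
Qed.
End GraphProbabilities.

(** * Clique counts inside a class and degree tails *)

Section MoreGraphProbabilities.
Context {R : realType} {V : finType}.
Variable p : R.
Hypotheses (p0 : 0 <= p) (p1 : p <= 1).
Implicit Types (G : graph V) (S K B : {set V}) (H : {set {set V}}).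

Lemma card_ksets_meet k S K j : K \subset S ->
  (#|[set K' in ksets k S | #|K :&: K'| == j]| <=
   'C(#|K|, j) * 'C(#|S| - #|K|, k - j))%N.
Proof.
move=> KS; rewrite -(setIidPr KS) -cardsD (setIidPr KS) -!cards_draws -cardsX.
pose f K' := (K :&: K', K' :\: K)%SET.
have fi : injective f.
  move=> K1 K2 [E1 E2]; rewrite -(finset.setID K1 K) -(finset.setID K2 K) E2.
  by rewrite ![(_ :&: K)%SET]finset.setIC E1.
rewrite -(card_imset _ fi); apply: subset_leq_card; apply/fintype.subsetP => x.
case/imsetP=> K'; rewrite !in_set => /andP[/andP[K'S /eqP K'k] /eqP Kj] ->.
rewrite /f /= ?in_set finset.subsetIl Kj eqxx /= finset.setSD //=.
by rewrite cardsD K'k finset.setIC Kj.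
Qed.

Lemma sum_ksets_meet k S K (F : nat -> R) : K \in ksets k S -> (forall j, 0 <= F j) ->
  \sum_(K' in ksets k S | (1 < #|K :&: K'|)%N) F #|K :&: K'| <=
  \sum_(2 <= j < k.+1) ('C(k, j) * 'C(#|S| - k, k - j))%:R * F j.
Proof.
rewrite inE => /andP[KS /eqP Kk] F0.
have Ik K' : (#|K :&: K'| < k.+1)%N.
  by rewrite ltnS -Kk subset_leq_card // finset.subsetIl.
rewrite (partition_big (fun K' => Ordinal (Ik K')) (fun j => (1 < j)%N)) /=; last first.
  by move=> K' /andP[].
rewrite [leRHS]big_geq_mkord /=; apply: ler_sum => j j1.
apply: (@le_trans _ _ (\sum_(K' in [set K' in ksets k S | #|K :&: K'| == j]) F j)).
  rewrite [leRHS]big_mkcond [leLHS]big_mkcond /=; apply: ler_sum => K' _.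
  rewrite [in leRHS]in_set -val_eqE /=; case: (K' \in ksets k S) => //=.
  by case: eqVneq => [->|]; rewrite ?andbF ?j1.
rewrite sumr_const -[leLHS]mulr_natl ler_wpM2r // ler_nat.
by have := @card_ksets_meet k S K j KS; rewrite Kk.
Qed.

(** The uncovered sets depend only on edges leaving [S], cliques in [S] only on edges inside it. Two
    k-sets sharing j vertices share 'C(j, 2) edges, so [Rb] dominates Janson's correlation ratio for
    every frozen family at once. *)
Lemma uncovered_clique_tail S k (h Rb : R) : (1 < k)%N -> 1 <= Rb -> 
  \sum_(2 <= j < k.+1) ('C(k, j) * 'C(#|S| - k, k - j))%:R *
     p ^+ ('C(k, 2) - 'C(j, 2)) <= Rb ->
  prob p (fun G => (h <= #|uncovered k S (~: S) G|%:R) &&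
     ~~ [exists K in uncovered k S (~: S) G, clique G K]) <=
  expR (- (h * p ^+ 'C(k, 2) / (4 * Rb))).
Proof.
move=> k1 Rb1 hRb.
(* Independence from [cross S] must hold for every [H], and [inner K] avoids [cross S] when
   [K \subset S]; hence the intersection with [ksets k S]. *)
pose Y H G := ~~ [exists K in H :&: ksets k S, inner K \subset G].
apply: le_trans (prob_freeze p0 p1 (U := cross S)
  (X := uncovered k S (~: S)) 
  (Q := fun H => (H \subset ksets k S) && (h <= #|H|%:R)) (Y := Y) _ _ (expR_ge0 _) _).
- apply: prob_sub => // G /andP[hh nc].
  rewrite uncoveredS hh /= /Y (setIidPl (uncoveredS _ _ _ _)); apply: contra nc.
  by case/exists_inP=> K KF KG; apply/exists_inP; exists K; rewrite ?inner_clique.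
- by move=> G G'; exact: uncovered_depends.
- move=> H G G' E; rewrite /Y; congr (_ %:R); congr (nat_of_bool (~~ _)).
  apply/eq_existsb => K; case: (boolP (K \in _)) => //=.
  rewrite in_setI => /andP[_]; rewrite inE => /andP[KS _].
  have sub : inner K \subset ~: cross S.
    rewrite -disjoints_subset disjoint_sym; apply: disjointWr (cross_inner S).
    by apply/fintype.subsetP => e; rewrite !in_set => /fintype.subset_trans; exact.
  have HX (X : {set vpair V}) : (inner K \subset X) = (inner K \subset X :&: ~: cross S).
    by rewrite subsetI sub andbT.
  by rewrite HX E -HX.
move=> H /andP[HS hH]; rewrite /Y (setIidPl HS).
have ci K : K \in H -> #|inner K| = 'C(k, 2).
  by move/(fintype.subsetP HS); rewrite inE card_inner => /andP[_ /eqP ->].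
apply: le_trans (@janson _ _ p p0 p1 _ (@inner V) H _ Rb Rb1 erefl _) _.
  move=> K KH; rewrite (ci K KH) mulrC.
  have KkS := fintype.subsetP HS K KH.
  have [KS Kk] : K \subset S /\ #|K| = k by move: KkS; rewrite inE => /andP[-> /eqP].
  have := @sum_ksets_meet k S K (fun j => p ^+ ('C(k, 2) - 'C(j, 2))) KkS.
  move=> /(_ (fun j => exprn_ge0 _ p0)) /le_trans /(_ hRb) hs.
  apply: le_trans (ler_wpM2l (exprn_ge0 _ p0) hs).
  (* The summand K' = K, with overlap j = k, supplies the diagonal term in the hypothesis of
     [janson]. *)
  rewrite mulr_sumr [leRHS](bigD1 K) /=; last by rewrite KkS finset.setIid Kk.
  apply: lerD; first by rewrite finset.setIid Kk subnn expr0 mulr1.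
  rewrite big_mkcond [leRHS]big_mkcond /=; apply: ler_sum => K' _.
  case: (boolP (K' \in H)) => K'H /=; last first.
    by case: ifP => // _; rewrite mulr_ge0 ?exprn_ge0.
  have K'kS := fintype.subsetP HS K' K'H.
  rewrite K'kS /= innerI (eq_sym K').
  rewrite andbC -card_gt0 card_inner bin_gt0; case: ifP => // /andP[h2 _].
  rewrite -exprD.
  have := cardsUI (inner K) (inner K').
  rewrite innerI card_inner (ci _ KH) (ci _ K'H) => E.
  rewrite (_ : (_ + (_ - _))%N = #|inner K :|: inner K'|) //.
  have := leq_bin2l 2 (subset_leq_card (finset.subsetIl K K')); rewrite Kk.
  move: E; set c := 'C(#|K :&: K'|, 2); move: 'C(k, 2) c #|_| => a c u E ca.
  by rewrite addnBA // -E addnK.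
rewrite ler_expR lerN2 ler_wpM2r ?invr_ge0 ?mulr_ge0 //; first lra.
rewrite (eq_bigr (fun=> p ^+ 'C(k, 2))); last by move=> K /ci ->.
by rewrite sumr_const -[leRHS]mulr_natl ler_wpM2r ?exprn_ge0.
Qed.

Lemma sum_subsets S (F : nat -> R) :
  \sum_(A : {set V} | A \subset S) F #|A| = \sum_(j < #|S|.+1) 'C(#|S|, j)%:R * F j.
Proof.
rewrite (partition_big (fun A : {set V} => inord #|A| : 'I_(#|S|.+1)) predT) //=.
apply: eq_bigr => j _.
rewrite (eq_bigl (fun A => A \in [set A : {set V} | A \subset S & #|A| == j])).
  rewrite (eq_bigr (fun=> F j)).
    by rewrite sumr_const cards_draws mulr_natl.
  by move=> A; rewrite in_set => /andP[_ /eqP ->].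
move=> A; rewrite in_set; case: (boolP (A \subset S)) => //= AS.
by rewrite -val_eqE /= inordK // ltnS subset_leq_card.
Qed.

(** Degrees up to [M] contribute at most 1. For a larger degree, the neighbourhood is some set [A]
    with [star v A \subset G], and all such [A] are summed with weight p^|A|. *)
Lemma expect_degree S M v (g : nat -> R) (delta : R) : v \notin S ->
  (forall d, 0 <= g d) -> (forall d, (d <= M)%N -> g d <= 1) ->
  \sum_(j < #|S|.+1 | (M < j)%N) 'C(#|S|, j)%:R * (p ^+ j * g j) <= delta ->
  expect p (fun G => g #|nbr G v :&: S|) <= 1 + delta.
Proof.
move=> vS g0 gM hd.
pose Fj j := if (M < j)%N then p ^+ j * g j else 0.
apply: (@le_trans _ _ (1 + \sum_(A : {set V} | A \subset S) Fj #|A|)); last first.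
  rewrite sum_subsets lerD2l; apply: le_trans hd; rewrite [leRHS]big_mkcond.
  by apply: ler_sum => j _; rewrite /Fj; case: ifP; rewrite ?mulr0.
apply: (@le_trans _ _ (expect p (fun G => 1 + \sum_(A : {set V} | A \subset S)
    (if (M < #|A|)%N then g #|A| else 0) * (star v A \subset G)%:R))).
  apply: ler_expect => // G; set N := nbr G v :&: S.
  have pos (P : pred {set V}) : 0 <= \sum_(A : {set V} | P A)
     (if (M < #|A|)%N then g #|A| else 0) * (star v A \subset G)%:R.
    by apply: sumr_ge0 => A _; rewrite mulr_ge0 ?ler0n //; case: ifP.
  case: (leqP #|N| M) => NM.
    by apply: le_trans (gM _ NM) _; rewrite lerDl pos.
  have NS : N \subset S by exact: finset.subsetIr.
  rewrite (bigD1 N) //= NM -star_subset; last first.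
    by apply: contra vS; exact: fintype.subsetP.
  by rewrite finset.subsetIl mulr1 addrCA lerDl addr_ge0 ?ler01 // pos.
rewrite expectD expect_cst lerD2l expect_sum; apply: ler_sum => A AS.
rewrite expectZ expect_subset card_star; last by apply: contra vS; exact: fintype.subsetP.
by rewrite /Fj; case: ifP; rewrite ?mul0r // mulrC.
Qed.

(** Stars of distinct outside vertices are disjoint, so exponential moments multiply. Halving [W]
    allows a weight as large as the logarithm of the inverse degree probability: half of that
    exponent remains for convergence. *)
Lemma heavy_tail S M (W : nat -> R) (delta y : R) :
  (forall d, (d <= M)%N -> W d <= 0) -> 0 <= delta ->
  \sum_(j < #|S|.+1 | (M < j)%N) 'C(#|S|, j)%:R * (p ^+ j * expR (W j / 2)) <= delta ->
  prob p (fun G => y <= \sum_(v in ~: S) W #|nbr G v :&: S|) <=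
  expR (- (y / 2)) * (1 + delta) ^+ #|V|.
Proof.
move=> WM d0 hd; pose g j := expR (W j / 2).
apply: le_trans (prob_markov p0 p1 (f := fun G =>
  expR (- (y / 2)) * \prod_(v <- enum (~: S)) g #|nbr G v :&: S|) _ _) _.
- by move=> G; rewrite mulr_ge0 ?expR_ge0 // prodr_ge0 // => v _; exact: expR_ge0.
- move=> G yW; rewrite big_enum /= -expR_sum -expRD -[leLHS]expR0 ler_expR -mulr_suml.
  lra.
rewrite expectZ ler_wpM2l ?expR_ge0 //.
rewrite (@expect_prod_indep _ _ _ _ _ (fun v => star v S)) ?enum_uniq //.
- apply: (@le_trans _ _ (\prod_(v <- enum (~: S)) (1 + delta))).
    rewrite big_seq [leRHS]big_seq; apply: ler_prod => v.
    rewrite mem_enum inE => vS; rewrite expect_ge0 //=; last first.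
      by move=> G; exact: expR_ge0.
    apply: (expect_degree vS (M := M)) => // d; first exact: expR_ge0.
    by move=> dM; rewrite /g -[leRHS]expR0 ler_expR pmulr_lle0 ?WM.
  rewrite big_enum prodr_const ler_weXn2l ?max_card //; lra.
- move=> v w; rewrite !mem_enum !inE; exact: star_disjoint.
- by move=> v; rewrite mem_enum inE => vS G G' /(nbr_depends vS) ->.
Qed.

Lemma degree_tail v j :
  prob p (fun G => (j <= #|nbr G v|)%N) <= 'C(#|V|.-1, j)%:R * p ^+ j.
Proof.
pose Q (A : {set V}) := (A \subset ~: [set v]) && (#|A| == j).
have -> : 'C(#|V|.-1, j)%:R * p ^+ j =
    \sum_(A : {set V} | Q A) prob p (fun G => star v A \subset G).
  rewrite (eq_bigr (fun=> p ^+ j)).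
    rewrite sumr_const mulr_natl; congr (_ *+ _).
    have -> : #|V|.-1 = #|~: [set v]| by rewrite cardsC1.
    by rewrite -cards_draws cardsE.
  move=> A /andP[Av /eqP <-]; rewrite /prob expect_subset card_star //.
  by apply: contraL Av => vA; apply/subsetPn; exists v; rewrite // !inE eqxx.
apply: le_trans (prob_exists p0 p1 _ _); apply: prob_sub => // G.
rewrite -bin_gt0 -cards_draws card_gt0 => /set0Pn[A]; rewrite in_set => /andP[AN Aj].
have vA : v \notin A.
  apply/negP => /(fintype.subsetP AN); rewrite inE => /adj_neq; by rewrite eqxx.
apply/existsP; exists A; rewrite /Q Aj -star_subset // AN !andbT.
by apply/fintype.subsetP => u uA; rewrite !inE; apply: contraNneq vA => <-.
Qed.

End MoreGraphProbabilities.

(** * The parameter regime *)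

Section Numerics.
Context {R : realType}.
Implicit Types (p L C x y : R) (n k s m j : nat).

Lemma bin_expR m j x : 0 <= x -> 'C(m, j)%:R * x ^+ j <= expR (m%:R * x).
Proof.
move=> x0; apply: (@le_trans _ _ ((1 + x) ^+ m)); last first.
  by rewrite expRM_natl lerXn2r ?nnegrE ?expR_ge0 ?expR_ge1Dx // addr_ge0.
case: (leqP j m) => jm; last by rewrite bin_small // mul0r exprn_ge0 // addr_ge0.
rewrite exprDn (bigD1 (inord j)) //= inordK // expr1n mul1r mulr_natl lerDl.
by apply: sumr_ge0 => i _; rewrite mulrn_wge0 // expr1n mul1r exprn_ge0.
Qed.

(** The bound C(m,j) <= (em/j)^j, written so that it also holds for j = 0 and m = 0. *)
Lemma bin_entropy m j : 'C(m, j)%:R * (j%:R / m%:R) ^+ j <= expR j%:R :> R.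
Proof.
apply: le_trans (bin_expR _ _ _) _; first by rewrite divr_ge0.
rewrite ler_expR mulrC; case: m => [|m]; first by rewrite mulr0.
by rewrite divfK // pnatr_eq0.
Qed.

Lemma bin_tail m j p : 0 < p -> (0 < j)%N -> (0 < m)%N ->
  'C(m, j)%:R * p ^+ j <= expR (- (j%:R * (ln (j%:R / (m%:R * p)) - 1))).
Proof.
move=> p0 j0 m0; have jr : 0 < j%:R :> R by rewrite ltr0n.
have mr : 0 < m%:R :> R by rewrite ltr0n.
rewrite mulrBr mulr1 opprB expRD expRN.
have -> : expR (j%:R * ln (j%:R / (m%:R * p))) = (j%:R / (m%:R * p)) ^+ j.
  by rewrite expRM_natl lnK // posrE divr_gt0 // mulr_gt0.
rewrite ler_pdivlMr ?exprn_gt0 ?divr_gt0 ?mulr_gt0 //.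
apply: le_trans (bin_entropy m j); rewrite -mulrA -exprMn.
suff -> : p * (j%:R / (m%:R * p)) = j%:R / m%:R by [].
field; lra.
Qed.

Lemma expR1_le4 : expR 1 <= 4 :> R.
Proof.
have h := @expR_quadratic R (1 / 2) (lexx _).
have -> : expR 1 = expR (1 / 2) * expR (1 / 2) :> R.
  by rewrite -expRD; congr expR; field.
have h2 : expR (1 / 2) <= 2 :> R by apply: le_trans h _; rewrite !expr2; lra.
apply: (@le_trans _ _ (2 * 2)); last by lra.
by apply: ler_pM; rewrite ?expR_ge0.
Qed.

(** Once the sequence descends it keeps descending, so its minimum over an interval is attained at
    an end. *)
Lemma unimodal_ge (a : nat -> R) (x : R) m N j : (m <= j <= N)%N ->
  (forall i, (m <= i)%N -> (i.+2 <= N)%N -> a i.+1 <= a i -> a i.+2 <= a i.+1) ->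
  x <= a m -> x <= a N -> x <= a j.
Proof.
move=> /andP[mj jN] H xm xN.
have dec i : (m <= i)%N -> (i < N)%N -> a i.+1 <= a i -> a N <= a i.+1.
  move=> mi iN; have [d Ed] : exists d, N = (i.+1 + d)%N.
    by exists (N - i.+1)%N; rewrite subnKC.
  elim: d i mi iN Ed => [|d IH] i mi iN Ed h; first by rewrite Ed addn0.
  have i2 : (i.+2 <= N)%N by rewrite Ed; lia.
  apply: le_trans (H i mi i2 h); apply: IH => //; first lia.
    by rewrite Ed; lia.
  exact: H.
have [d Ed] : exists d, j = (m + d)%N by exists (j - m)%N; rewrite subnKC.
subst j; elim: d jN {mj} => [|d IH]; first by rewrite addn0.
rewrite addnS => jN; case: (leP (a (m + d)%N) (a (m + d).+1)) => h.
  by apply: le_trans h; apply: IH; exact: ltnW.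
by apply: le_trans xN _; apply: dec (ltW h) => //; exact: leq_addr.
Qed.

(* [s] is the size of the colour classes, [L] stands for log(1/p). *)
Record regime C p L n k s : Prop := Regime {
  C_large : 32 ^+ 4 <= C;
  k_gt1 : (1 < k)%N;
  s_gt0 : (0 < s)%N;
  s_le_n : (s <= n)%N;
  n_ge2 : (2 <= n)%N;
  pE : p = expR (- L);
  p_small : 6 * C * p <= 1;
  np_large : 4 * ln n%:R <= n%:R * p;
  p_upper : (6 * C * p) ^+ (2 * k.-1) * (k%:R ^+ 2 * L * (n%:R * p)) <=
            ((1 - p ^+ k) ^+ n) ^+ 2;
  s_degree : C ^+ 2 * (n%:R * p) <= s%:R;
  s_cliques : C ^+ (2 * k.-1) * (k`!%:R * k%:R * L) <=
              s%:R ^+ k.-1 * (1 - p ^+ k) ^+ n * p ^+ 'C(k, 2);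
  s_pairs : (2 < k)%N -> C ^+ 2 * (k%:R ^+ 5 * L) <= s%:R * p * (1 - p ^+ k) ^+ n }.

Section Regime.
Variables (C p L : R) (n k s : nat).
Hypothesis reg : regime C p L n k s.
Local Notation phi := ((1 - p ^+ k) ^+ n).

Lemma regime_C : 1000 * 1000 <= C.
Proof. have := C_large reg; rewrite !exprS expr0; lra. Qed.

Lemma regime_p_gt0 : 0 < p.
Proof. by rewrite (pE reg) expR_gt0. Qed.

Lemma regime_expL : 6 * C <= expR L.
Proof.
have h := p_small reg; rewrite (pE reg) expRN ler_pdivrMr ?expR_gt0 // mul1r in h.
exact: h.
Qed.

Lemma regime_expL4 : 32 <= expR (L / 4).
Proof.
have h : 32 ^+ 4 <= expR L.
  by apply: le_trans regime_expL; have := C_large reg; have := regime_C; lra.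
rewrite (_ : L = 4%:R * (L / 4)) in h; last by field.
rewrite expRM_natl in h.
by rewrite -(ler_pXn2r (n := 4)) ?nnegrE ?expR_ge0.
Qed.

Lemma regime_L : 8 <= L.
Proof.
have h : expR 2 <= expR (L / 4).
  apply: le_trans regime_expL4.
  have -> : (2 : R) = 1 + 1 by [].
  rewrite expRD; apply: (@le_trans _ _ (4 * 4)); last by lra.
  by apply: ler_pM; rewrite ?expR_ge0 ?expR1_le4.
rewrite ler_expR in h; lra.
Qed.

Lemma regime_expLhalf : 8 * L <= expR (L / 2).
Proof.
have -> : L / 2 = L / 4 + L / 4 by field.
rewrite expRD; have h1 := regime_expL4; have h2 := expR_ge1Dx (L / 4).
have h3 := regime_L.
apply: (@le_trans _ _ (32 * (L / 4))); first by lra.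
by apply: ler_pM; lra.
Qed.

Lemma regime_p_lt1 : p < 1.
Proof.
rewrite (pE reg) -[ltRHS]expR0 ltr_expR; have := regime_L; lra.
Qed.

Lemma regime_pk : 0 < 1 - p ^+ k.
Proof.
rewrite subr_gt0 exprn_ilt1 ?ltW ?regime_p_gt0 ?regime_p_lt1 //.
by have := k_gt1 reg; case: k.
Qed.

Lemma regime_phi0 : 0 < phi.
Proof. by rewrite exprn_gt0 // regime_pk. Qed.

Lemma regime_phi1 : phi <= 1.
Proof.
apply: exprn_ile1; first exact: ltW regime_pk.
by rewrite lerBlDr lerDl exprn_ge0 // ltW // regime_p_gt0.
Qed.

Lemma regime_n : 0 < n%:R :> R.
Proof. by have := n_ge2 reg; rewrite ltr0n; case: n. Qed.

Lemma regime_s : 0 < s%:R :> R.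
Proof. by rewrite ltr0n (s_gt0 reg). Qed.

(** For k = 2 this comes from [s_cliques], whose exponent 'C(2, 2) is 1; for k >= 3 it comes from
    [s_pairs]. *)
Lemma regime_spphi : C ^+ 2 * L <= s%:R * p * phi.
Proof.
have L8 := regime_L; have C0 := regime_C.
have CL0 : 0 <= C ^+ 2 * L by rewrite mulr_ge0 ?sqr_ge0 //; lra.
have := k_gt1 reg; rewrite leq_eqVlt => /orP[/eqP k2|k3].
  have := s_cliques reg; rewrite -k2 /= binn expr1 muln1 -[2`!]/2%N.
  rewrite -[in X in _ <= X -> _]mulrA [X in _ <= _ * X -> _]mulrC mulrA.
  move: CL0; lra.
apply: le_trans (s_pairs reg k3); rewrite ler_wpM2l ?sqr_ge0 //.
rewrite ler_peMl //; first by lra.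
by rewrite exprn_ege1 // ler1n; lia.
Qed.

Lemma regime_sp : C ^+ 2 * L <= s%:R * p.
Proof.
apply: le_trans regime_spphi _; rewrite ler_piMr ?regime_phi1 //.
by rewrite mulr_ge0 // ltW ?regime_p_gt0.
Qed.

Lemma regime_ln_n : 0 <= ln n%:R :> R.
Proof. by rewrite ln_ge0 // ler1n; have := n_ge2 reg; case: n. Qed.

(** If L is of order log n, [regime_sp] suffices. Otherwise s p >= C^2 n p^2, and n p^2 = e^(log n -
    2L) is at least log n / 2 by e^x >= 1 + x. *)
Lemma regime_splogn : C ^+ 2 / 4 * ln n%:R <= s%:R * p.
Proof.
have L8 := regime_L; have C0 := regime_C; have l0 := regime_ln_n.
have C2 : 0 <= C ^+ 2 by exact: sqr_ge0.
case: (lerP L (ln n%:R / 4)) => hL; last first.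
  apply: le_trans regime_sp.
  have -> : C ^+ 2 / 4 * ln n%:R = C ^+ 2 * (ln n%:R / 4) by field.
  by rewrite ler_wpM2l //; lra.
have h1 : C ^+ 2 * (n%:R * p) * p <= s%:R * p.
  by rewrite ler_wpM2r ?(s_degree reg) // ltW ?regime_p_gt0.
apply: le_trans h1.
have -> : C ^+ 2 / 4 * ln n%:R = C ^+ 2 * (ln n%:R / 4) by field.
have -> : C ^+ 2 * (n%:R * p) * p = C ^+ 2 * (n%:R * (p * p)) by ring.
rewrite ler_wpM2l //.
have -> : n%:R * (p * p) = expR (ln n%:R - L - L).
  by rewrite !expRD lnK ?posrE ?regime_n // -(pE reg) mulrA.
apply: le_trans (expR_ge1Dx _); lra.
Qed.

Lemma regime_Llogn : L <= ln n%:R.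
Proof.
have n0 := regime_n; have h : 1 <= n%:R * p.
  apply: le_trans (np_large reg).
  have : ln 2 <= ln n%:R :> R by rewrite ler_ln ?posrE // ler_nat (n_ge2 reg).
  have : expR (1 / 4 : R) <= 2.
    by have := @expR_quadratic R (1 / 4); rewrite !expr2; lra.
  rewrite -[X in _ <= X -> _](lnK (x := 2)) ?posrE // ler_expR; lra.
rewrite -ler_expR lnK ?posrE //.
rewrite (pE reg) expRN ler_pdivlMr ?expR_gt0 // mul1r in h; exact: h.
Qed.

Lemma regime_np4L : 4 * L <= n%:R * p.
Proof. by have := np_large reg; have := regime_Llogn; lra. Qed.

(** Here y is a degree divided by s. For y >= e^(-L/2) the logarithm leaves L/2 - 1, against at most
    L/4 on the left since y <= 1/32. For smaller y the left side is at most 1, while y > C/10 p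
    makes the right side at least 1. *)
Lemma bad_degree_ineq y : C / 10 * p < y -> y <= 16 / C ^+ 2 ->
  8 * L * y <= ln y - 1 + L.
Proof.
move=> hy1 hy2; have C0 := regime_C; have L8 := regime_L.
have Cp : 0 < C / 10 * p by rewrite mulr_gt0 ?regime_p_gt0 //; lra.
have y0 : 0 < y by lra.
case: (lerP (expR (- (L / 2))) y) => hy.
  have h1 : - (L / 2) <= ln y by rewrite -ler_expR lnK.
  have h2 : y <= 1 / 32.
    apply: le_trans hy2 _; rewrite ler_pdivrMr ?exprn_gt0 //; last by lra.
    rewrite expr2; have : 1000 * 1000 <= C * C by apply: ler_pM; lra.
    lra.
  have : 8 * L * y <= 8 * L * (1 / 32) by rewrite ler_wpM2l //; lra.
  lra.
have h1 : ln (C / 10) - L < ln y.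
  rewrite -ltr_expR lnK ?posrE // expRD -(pE reg) lnK ?posrE //; lra.
have h2 : 2 <= ln (C / 10).
  rewrite -ler_expR lnK ?posrE; last by lra.
  have -> : (2 : R) = 1 + 1 by [].
  rewrite expRD; apply: (@le_trans _ _ (4 * 4)); last by lra.
  by apply: ler_pM; rewrite ?expR_ge0 ?expR1_le4.
have h3 : 8 * L * y <= 1.
  apply: (@le_trans _ _ (expR (L / 2) * expR (- (L / 2)))).
    by apply: ler_pM; [lra | lra | exact: regime_expLhalf | exact: ltW].
  by rewrite -expRD subrr expR0.
lra.
Qed.

(* A lower bound on [cliqued j] bounds the contribution to Janson's correlation
   sum of the pairs of k-sets sharing j vertices; being unimodal in [j], it is
   smallest at j = 2 or j = k. *)
Definition cliqued j : R := phi * ('C(s, j)%:R * p ^+ 'C(j, 2)) / 'C(k, j)%:R ^+ 2.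

Lemma regime_2k : (2 * k <= s)%N.
Proof.
have L8 := regime_L; have C0 := regime_C.
rewrite -(ler_nat R); have sp : s%:R * p * phi <= s%:R.
  have := regime_phi1; have := regime_phi0; have := regime_p_lt1.
  have p0 := regime_p_gt0 => p1 f0 f1; rewrite -mulrA ler_piMr //.
  by rewrite mulr_ile1 // ltW.
apply: le_trans sp; have C1 : 1000 <= C ^+ 2.
  rewrite expr2; have : 1000 * 1 <= C * C by apply: ler_pM; lra.
  lra.
have := k_gt1 reg; rewrite leq_eqVlt => /orP[/eqP k2|k3].
  apply: le_trans regime_spphi; rewrite -k2.
  have : 1000 * 8 <= C ^+ 2 * L by apply: ler_pM; lra.
  lra.
apply: le_trans (s_pairs reg k3).
have k1 : 1 <= k%:R :> R by rewrite ler1n; lia.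
have h5 : k%:R <= k%:R ^+ 5 :> R by rewrite -[leLHS]expr1 ler_weXn2l.
have h6 : k%:R * 1 <= k%:R ^+ 5 * L by apply: ler_pM; lra.
have : 1000 * k%:R <= C ^+ 2 * (k%:R ^+ 5 * L) by apply: ler_pM; lra.
rewrite natrM; lra.
Qed.
End Regime.
End Numerics.

(** * Binomial estimates and Janson's correlation sum *)

Section MoreNumerics.
Context {R : realType}.
Implicit Types (x y : R) (m j : nat).

Lemma bin_chain (s k j : nat) : (j <= k)%N -> (k <= s)%N ->
  ('C(s, j) * 'C(s - k, k - j) <= 'C(s, k) * 'C(k, j))%N.
Proof.
move=> jk ks; have js := leq_trans jk ks.
suff -> : ('C(s, k) * 'C(k, j) = 'C(s, j) * 'C(s - j, k - j))%N.
  by rewrite leq_mul2l leq_bin2l ?orbT // leq_sub2l.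
have Hf : (0 < j`! * ((k - j)`! * (s - k)`!))%N by rewrite !muln_gt0 !fact_gt0.
apply/eqP; rewrite -(eqn_pmul2r Hf); apply/eqP.
have E1 := bin_fact ks; have E2 := bin_fact jk; have E3 := bin_fact js.
have E4 := bin_fact (leq_sub2r j ks).
have sk : (s - j - (k - j) = s - k)%N by lia.
rewrite sk in E4.
transitivity (s`!).
  by rewrite -E1 -E2; ring.
by rewrite -E3 -E4; ring.
Qed.

Lemma ffact_scale (m s j : nat) : (m <= s)%N ->
  (m.-1 ^_ j * s ^ j <= s.-1 ^_ j * m ^ j)%N.
Proof.
move=> ms; elim: j => [|j IH]; first by rewrite !expn0.
rewrite !ffactnSr !expnSr.
have h : ((m.-1 - j) * s <= (s.-1 - j) * m)%N.
  have -> : (m.-1 - j = m - j.+1)%N by lia.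
  have -> : (s.-1 - j = s - j.+1)%N by lia.
  rewrite !mulnBl [(s * m)%N]mulnC; apply: leq_sub2l.
  by rewrite leq_mul2l ms orbT.
have -> : (m.-1 ^_ j * (m.-1 - j) * (s ^ j * s) = (m.-1 ^_ j * s ^ j) * ((m.-1 - j) * s))%N by ring.
have -> : (s.-1 ^_ j * (s.-1 - j) * (m ^ j * m) = (s.-1 ^_ j * m ^ j) * ((s.-1 - j) * m))%N by ring.
exact: leq_mul.
Qed.

(** C(m-1,k-1)/C(s-1,k-1) <= (m/s)^(k-1) factor by factor, and C(s-1,k-1) = (k/s) C(s,k). It serves
    twice: for the Lipschitz constant, with m the cutoff, and for the k-sets covered by a heavy
    vertex, with m its degree. *)
Lemma bin_scale (m s k : nat) (r : R) : (0 < k)%N -> (0 < s)%N -> (m <= s)%N ->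
  m%:R <= r * s%:R ->
  'C(m.-1, k.-1)%:R <= k%:R / s%:R * r ^+ k.-1 * 'C(s, k)%:R.
Proof.
case: k => // k _ s0 ms mr /=.
have sr : 0 < s%:R :> R by rewrite ltr0n.
have h1 : ('C(m.-1, k) * s ^ k <= 'C(s.-1, k) * m ^ k)%N.
  have := ffact_scale k ms; rewrite -!bin_ffact.
  rewrite ![(_ * k`!)%N]mulnC -!mulnA leq_pmul2l //; exact: fact_gt0.
have h2 : (s * 'C(s.-1, k) = k.+1 * 'C(s, k.+1))%N by rewrite mul_bin_diag.
have r0 : 0 <= r by rewrite -(pmulr_lge0 _ sr); apply: le_trans mr.
have h3 : 'C(m.-1, k)%:R * s%:R ^+ k <= 'C(s.-1, k)%:R * (r * s%:R) ^+ k :> R.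
  apply: (@le_trans _ _ ('C(s.-1, k)%:R * m%:R ^+ k)).
    by rewrite -!natrX -!natrM ler_nat.
  by rewrite ler_wpM2l // lerXn2r ?nnegrE // mulr_ge0.
rewrite exprMn mulrA ler_pM2r ?exprn_gt0 // in h3.
apply: le_trans h3 _.
have -> : k.+1%:R / s%:R * r ^+ k * 'C(s, k.+1)%:R =
   (k.+1%:R * 'C(s, k.+1)%:R) / s%:R * r ^+ k by field; lra.
by rewrite -natrM -h2 natrM [s%:R * _]mulrC mulfK // gt_eqF.
Qed.

(** Give each set [B] the weight n^(b-|B|), which is at least 1 on the sets counted; the total
    weight is n^b (1+1/n)^n <= e n^b. *)
Lemma card_small_sets (V : finType) (b : R) : (1 < #|V|)%N ->
  #|[set B : {set V} | #|B|%:R <= b]|%:R <= expR (1 + b * ln #|V|%:R).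
Proof.
move=> V1; have n0 : 0 < #|V|%:R :> R by rewrite ltr0n; apply: ltnW.
have l0 : 0 <= ln #|V|%:R :> R by rewrite ln_ge0 // ler1n ltnW.
apply: (@le_trans _ _ (\sum_(B : {set V} | B \subset setT)
    expR (b * ln #|V|%:R) * #|V|%:R^-1 ^+ #|B|)).
  rewrite -sum1_card natr_sum big_mkcond [leRHS]big_mkcond /=; apply: ler_sum => B _.
  rewrite in_set finset.subsetT; case: ifP => hB; last first.
    by rewrite mulr_ge0 ?expR_ge0 ?exprn_ge0 // invr_ge0 ltW.
  have -> : #|V|%:R^-1 ^+ #|B| = expR (- (#|B|%:R * ln #|V|%:R)) :> R.
    by rewrite expRN expRM_natl lnK ?posrE // exprVn.
  rewrite -expRD -[leLHS]expR0 ler_expR -mulrBl mulr_ge0 //; lra.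
rewrite (sum_subsets setT (fun j => expR (b * ln #|V|%:R) * #|V|%:R^-1 ^+ j)) finset.cardsT.
under eq_bigr do rewrite mulrCA.
rewrite -mulr_sumr addrC expRD ler_wpM2l ?expR_ge0 //.
have -> : \sum_(i < #|V|.+1) 'C(#|V|, i)%:R * #|V|%:R^-1 ^+ i = (1 + #|V|%:R^-1) ^+ #|V| :> R.
  by rewrite exprDn; apply: eq_bigr => i _; rewrite expr1n mul1r mulr_natl.
apply: (@le_trans _ _ (expR (#|V|%:R^-1) ^+ #|V|)).
  by rewrite lerXn2r ?nnegrE ?expR_ge0 ?expR_ge1Dx // addr_ge0 // invr_ge0 ltW.
by rewrite -expRM_natl mulfV // gt_eqF.
Qed.

Section Regime.
Variables (C p L : R) (n k s : nat).
Hypothesis reg : regime C p L n k s.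
Local Notation phi := ((1 - p ^+ k) ^+ n).
Local Notation cliqued := (cliqued p n k s).

Lemma regime_ks : (k <= s)%N.
Proof. by apply: leq_trans (regime_2k reg); rewrite mul2n -addnn leq_addr. Qed.

Lemma cliqued_gt0 j : (j <= k)%N -> 0 < cliqued j.
Proof.
move=> jk; rewrite /cliqued divr_gt0 ?exprn_gt0 ?ltr0n ?bin_gt0 //.
rewrite mulr_gt0 ?(regime_phi0 reg) // mulr_gt0 ?exprn_gt0 ?(regime_p_gt0 reg) //.
by rewrite ltr0n bin_gt0 (leq_trans jk) // regime_ks.
Qed.

Lemma cliquedS j : (j < k)%N -> cliqued j.+1 =
  cliqued j * ((s - j)%:R * j.+1%:R * p ^+ j / (k - j)%:R ^+ 2).
Proof.
move=> jk; rewrite /cliqued.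
have e1 : 'C(s, j.+1)%:R = 'C(s, j)%:R * (s - j)%:R / j.+1%:R :> R.
  by rewrite -natrM mulnC -mul_bin_left natrM mulrC mulKf // pnatr_eq0.
have e2 : 'C(k, j.+1)%:R = 'C(k, j)%:R * (k - j)%:R / j.+1%:R :> R.
  by rewrite -natrM mulnC -mul_bin_left natrM mulrC mulKf // pnatr_eq0.
have e3 : 'C(j.+1, 2) = ('C(j, 2) + j)%N by rewrite binS bin1.
rewrite e1 e2 e3 exprD.
have h1 : 'C(k, j)%:R != 0 :> R by rewrite pnatr_eq0 -lt0n bin_gt0 ltnW.
have h2 : (k - j)%:R != 0 :> R by rewrite pnatr_eq0 subn_eq0 -ltnNge.
have h3 : j.+1%:R != 0 :> R by rewrite pnatr_eq0.
move: h1 h2 h3; move: 'C(k, j)%:R (k - j)%:R j.+1%:R 'C(s, j)%:R (s - j)%:R.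
by move=> a b c d e a0 b0 c0; field; rewrite a0 b0 c0.
Qed.

(** The ratio of consecutive terms does not increase: passing to the next one multiplies it by at
    most p * 2 * 4 = 8p <= 1. *)
Lemma cliqued_unimodal j : (j.+2 <= k)%N -> cliqued j.+1 <= cliqued j ->
  cliqued j.+2 <= cliqued j.+1.
Proof.
move=> jk; have j1 : (j < k)%N by exact: ltnW.
rewrite [cliqued j.+2]cliquedS // {1}[cliqued j.+1]cliquedS //.
rewrite !ger_pMr ?cliqued_gt0 //; last exact: ltnW.
move=> h; apply: le_trans h; have p0 := regime_p_gt0 reg.
have [u Eu] : exists u : nat, (k - j = u.+2)%N by exists (k - j.+2)%N; lia.
have -> : (k - j.+1 = u.+1)%N by lia.
rewrite Eu ler_pdivrMr ?exprn_gt0 // [leRHS]mulrAC ler_pdivlMr ?exprn_gt0 //.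
have -> : p ^+ j.+1 = p * p ^+ j by rewrite exprS.
have hs : (s - j.+1)%:R <= (s - j)%:R :> R by rewrite ler_nat; lia.
have hu : u.+2%:R <= 2 * u.+1%:R :> R by rewrite -natrM ler_nat; lia.
have hu2 : u.+2%:R ^+ 2 <= 4 * u.+1%:R ^+ 2 :> R.
  have -> : 4 * u.+1%:R ^+ 2 = (2 * u.+1%:R) ^+ 2 :> R by ring.
  by rewrite lerXn2r ?nnegrE // mulr_ge0.
have hj : j.+2%:R <= 2 * j.+1%:R :> R by rewrite -natrM ler_nat; lia.
have hp : 8 * p <= 1.
  have := p_small reg; have : 6 * (1000 * 1000) * p <= 6 * C * p.
    by rewrite ler_wpM2r ?(ltW p0) // ler_wpM2l // (regime_C reg).
  lra.
have -> : (s - j.+1)%:R * j.+2%:R * (p * p ^+ j) * u.+2%:R ^+ 2 =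
  p ^+ j * ((s - j.+1)%:R * (p * (j.+2%:R * u.+2%:R ^+ 2))) by ring.
have -> : (s - j)%:R * j.+1%:R * p ^+ j * u.+1%:R ^+ 2 =
  p ^+ j * ((s - j)%:R * (j.+1%:R * u.+1%:R ^+ 2)) by ring.
rewrite ler_wpM2l ?exprn_ge0 ?(ltW p0) //.
apply: ler_pM => //; first by rewrite !mulr_ge0 ?exprn_ge0 // ltW.
apply: (@le_trans _ _ (p * (2 * j.+1%:R * (4 * u.+1%:R ^+ 2)))).
  rewrite ler_wpM2l ?(ltW p0) //; apply: ler_pM => //; exact: exprn_ge0.
have -> : p * (2 * j.+1%:R * (4 * u.+1%:R ^+ 2)) = 8 * p * (j.+1%:R * u.+1%:R ^+ 2) by ring.
by rewrite ler_piMl // mulr_ge0 // exprn_ge0.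
Qed.

(** Since 2k <= s, C(s,k) k! >= (s/2)^k; the lost 2^k and the constant 32 are absorbed by C^(2(k-1))
    in [s_cliques]. *)
Lemma cliqued_k : 32 * (k%:R * s%:R * L) <= cliqued k.
Proof.
have p0 := regime_p_gt0 reg; have L8 := regime_L reg; have C0 := regime_C reg.
have f0 := regime_phi0 reg; have s0 := regime_s reg.
rewrite /cliqued binn expr1n divr1.
have kr : 0 < k`!%:R :> R by rewrite ltr0n fact_gt0.
have hC : (s%:R / 2) ^+ k <= 'C(s, k)%:R * k`!%:R :> R.
  rewrite -natrM bin_ffact ffact_prod natr_prod -[X in _ ^+ X]card_ord -prodr_const.
  apply: ler_prod => i _; rewrite divr_ge0 //= ler_pdivrMr // -natrM ler_nat.
  have := regime_2k reg; have := ltn_ord i; lia.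
have hp2 : 32 * 2 ^+ k <= C ^+ (2 * k.-1).
  have := k_gt1 reg; case: (k) => // -[|k'] // _ /=.
  apply: (@le_trans _ _ ((64 * 2) ^+ k'.+1)).
    rewrite exprMn [2 ^+ k'.+2]exprS mulrA ler_wpM2r ?exprn_ge0 //.
    rewrite (_ : 32 * 2 = 64); last by ring.
    by rewrite -[leLHS]expr1 ler_weXn2l // ler1n.
  rewrite exprM lerXn2r ?nnegrE ?sqr_ge0 ?mulr_ge0 //.
  rewrite expr2; have : 1000 * 1000 <= C * C by apply: ler_pM; lra.
  lra.
have hs := s_cliques reg.
have sk : s%:R ^+ k = s%:R * s%:R ^+ k.-1 :> R.
  by rewrite -exprS prednK //; apply: ltnW (k_gt1 reg).
rewrite expr_div_n ler_pdivrMr ?exprn_gt0 // sk in hC.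
have t0 : 0 < k`!%:R * 2 ^+ k :> R by rewrite mulr_gt0 ?exprn_gt0.
rewrite -(ler_pM2r t0).
apply: (@le_trans _ _ (s%:R * (C ^+ (2 * k.-1) * (k`!%:R * k%:R * L)))).
  have -> : 32 * (k%:R * s%:R * L) * (k`!%:R * 2 ^+ k) =
    32 * 2 ^+ k * (s%:R * (k`!%:R * k%:R * L)) by ring.
  rewrite [leLHS]mulrCA ler_wpM2l // ler_wpM2r // !mulr_ge0 //; lra.
apply: (@le_trans _ _ (s%:R * (s%:R ^+ k.-1 * phi * p ^+ 'C(k, 2)))).
  by rewrite ler_wpM2l.
have -> : s%:R * (s%:R ^+ k.-1 * phi * p ^+ 'C(k, 2)) =
  (phi * p ^+ 'C(k, 2)) * (s%:R * s%:R ^+ k.-1) by ring.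
have -> : phi * ('C(s, k)%:R * p ^+ 'C(k, 2)) * (k`!%:R * 2 ^+ k) =
  (phi * p ^+ 'C(k, 2)) * ('C(s, k)%:R * k`!%:R * 2 ^+ k) by ring.
by rewrite ler_wpM2l // mulr_ge0 ?exprn_ge0 // ltW ?(regime_pk reg).
Qed.

Lemma bin2_double (m : nat) : ('C(m, 2) * 2 = m * m.-1)%N.
Proof. by have := mul_bin_diag m 1; rewrite bin1 => ->; rewrite mulnC. Qed.

(** Of the k^5 in [s_pairs], one factor k is the one in the bound and k^4 pays for 'C(k, 2)^2. *)
Lemma cliqued_2 : 32 * (k%:R * s%:R * L) <= cliqued 2.
Proof.
have := k_gt1 reg; rewrite leq_eqVlt => /orP[/eqP E|k3].
  by have := cliqued_k; rewrite -E.
have p0 := regime_p_gt0 reg; have L8 := regime_L reg; have C0 := regime_C reg.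
have f0 := regime_phi0 reg; have s0 := regime_s reg.
have kr : 0 < k%:R :> R by rewrite ltr0n; lia.
rewrite /cliqued (binn 2) expr1.
have k2 : (0 < 'C(k, 2))%N by rewrite bin_gt0; lia.
rewrite ler_pdivlMr ?exprn_gt0 ?ltr0n //.
have hk : 'C(k, 2)%:R ^+ 2 <= k%:R ^+ 4 / 4 :> R.
  have h2 : 'C(k, 2)%:R <= k%:R ^+ 2 / 2 :> R.
    rewrite ler_pdivlMr // -natrM -natrX ler_nat bin2_double; nia.
  have -> : k%:R ^+ 4 / 4 = (k%:R ^+ 2 / 2) ^+ 2 :> R by field.
  by rewrite lerXn2r ?nnegrE // divr_ge0 // exprn_ge0.
have hs2 : s%:R * s%:R <= 4 * 'C(s, 2)%:R :> R.
  rewrite -!natrM ler_nat; have := bin2_double s; have := regime_2k reg; nia.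
have := s_pairs reg k3 => h.
have h1 := ler_wpM2l (ltW s0) h.
apply: (@le_trans _ _ (32 * (k%:R * s%:R * L) * (k%:R ^+ 4 / 4))).
  by rewrite ler_wpM2l // !mulr_ge0 //; lra.
have hC : 1000 <= C ^+ 2.
  rewrite expr2; have : 1000 * 1 <= C * C by apply: ler_pM; lra.
  lra.
apply: (@le_trans _ _ (s%:R * (s%:R * p * phi) / 4)).
  apply: le_trans (_ : s%:R * (C ^+ 2 * (k%:R ^+ 5 * L)) / 4 <= _); last by lra.
  have -> : 32 * (k%:R * s%:R * L) * (k%:R ^+ 4 / 4) = s%:R * (32 * (k%:R ^+ 5 * L)) / 4 by field.
  rewrite ler_wpM2r // ler_wpM2l //.
  by rewrite ler_wpM2r ?mulr_ge0 ?exprn_ge0 //; lra.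
have -> : s%:R * (s%:R * p * phi) / 4 = (p * phi / 4) * (s%:R * s%:R) by field.
have -> : phi * ('C(s, 2)%:R * p) = (p * phi / 4) * (4 * 'C(s, 2)%:R) by field.
by rewrite ler_wpM2l // divr_ge0 // mulr_ge0 // ltW.
Qed.

Lemma cliqued_ge j : (2 <= j <= k)%N -> 32 * (k%:R * s%:R * L) <= cliqued j.
Proof.
move=> jk; apply: (unimodal_ge (a := cliqued) jk) cliqued_2 cliqued_k => i _.
exact: cliqued_unimodal.
Qed.

(* Chosen so that the exponent in [uncovered_clique_tail] becomes [2 s L]. *)
Definition overlap : R := phi * ('C(s, k)%:R * p ^+ 'C(k, 2)) / (32 * (s%:R * L)).

Lemma overlap_ge1 : 1 <= overlap.
Proof.
have L8 := regime_L reg; have s0 := regime_s reg.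
have sL : 0 < s%:R * L by rewrite mulr_gt0 //; lra.
rewrite ler_pdivlMr ?mul1r ?mulr_gt0 //; last by lra.
have := cliqued_k; rewrite /cliqued binn expr1n divr1; apply: le_trans.
rewrite ler_wpM2l // -mulrA ler_peMl ?(ltW sL) // ler1n.
exact: ltnW (k_gt1 reg).
Qed.

(** By [cliqued_ge] and [bin_chain] each of the k-1 summands is at most overlap/k; this is why the
    bound on [cliqued] carries a factor k. *)
Lemma overlap_sum :
  \sum_(2 <= j < k.+1) ('C(k, j) * 'C(s - k, k - j))%:R *
     p ^+ ('C(k, 2) - 'C(j, 2)) <= overlap.
Proof.
have p0 := regime_p_gt0 reg; have L8 := regime_L reg.
have f0 := regime_phi0 reg; have s0 := regime_s reg.
have kr : 0 < k%:R :> R by rewrite ltr0n; exact: ltnW (k_gt1 reg).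
have sL : 0 < s%:R * L by rewrite mulr_gt0 //; lra.
have L0 : 0 < L by lra.
have o0 : 0 <= overlap by apply: le_trans overlap_ge1.
have term j : (2 <= j <= k)%N -> ('C(k, j) * 'C(s - k, k - j))%:R *
     p ^+ ('C(k, 2) - 'C(j, 2)) <= overlap / k%:R.
  move=> /andP[j2 jk]; have := @cliqued_ge j; rewrite j2 jk => /(_ isT).
  have b0 : 0 < 'C(k, j)%:R :> R by rewrite ltr0n bin_gt0.
  rewrite /cliqued ler_pdivlMr ?exprn_gt0 // => h.
  have e : p ^+ 'C(k, 2) = p ^+ 'C(j, 2) * p ^+ ('C(k, 2) - 'C(j, 2)).
    by rewrite -exprD subnKC // leq_bin2l.
  rewrite /overlap e !ler_pdivlMr ?mulr_gt0 // -(ler_pM2r b0).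
  set q := p ^+ ('C(k, 2) - 'C(j, 2)); have q0 : 0 <= q by rewrite exprn_ge0 // ltW.
  apply: (@le_trans _ _ (phi * ('C(s, j)%:R * p ^+ 'C(j, 2)) * ('C(s - k, k - j)%:R * q))).
    have -> : ('C(k, j) * 'C(s - k, k - j))%:R * q * k%:R * (32 * (s%:R * L)) * 'C(k, j)%:R =
      32 * (k%:R * s%:R * L) * 'C(k, j)%:R ^+ 2 * ('C(s - k, k - j)%:R * q).
      by rewrite natrM; ring.
    by rewrite ler_wpM2r // mulr_ge0.
  have -> : phi * ('C(s, j)%:R * p ^+ 'C(j, 2)) * ('C(s - k, k - j)%:R * q) =
    phi * p ^+ 'C(j, 2) * q * ('C(s, j) * 'C(s - k, k - j))%:R by rewrite natrM; ring.
  have -> : phi * ('C(s, k)%:R * (p ^+ 'C(j, 2) * q)) * 'C(k, j)%:R =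
    phi * p ^+ 'C(j, 2) * q * ('C(s, k) * 'C(k, j))%:R by rewrite natrM; ring.
  rewrite ler_wpM2l ?mulr_ge0 ?exprn_ge0 ?(ltW p0) ?(ltW (regime_pk reg)) //.
  by rewrite ler_nat bin_chain // regime_ks.
apply: (@le_trans _ _ (\sum_(2 <= j < k.+1) overlap / k%:R)).
  by apply: ler_sum_nat => j; rewrite ltnS; exact: term.
rewrite sumr_const_nat -[leLHS]mulr_natr -mulrA ler_piMr // mulrC.
rewrite ler_pdivrMr // mul1r ler_nat; lia.
Qed.

End Regime.
End MoreNumerics.

(** * Failure probabilities *)

Section FailureProbabilities.
Context {R : realType} {V : finType}.
Variables (C p L : R) (n k s : nat).
Hypothesis reg : regime C p L n k s.
Hypothesis cardV : #|V| = n.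
Implicit Types (G : graph V) (S K B : {set V}).
Local Notation phi := ((1 - p ^+ k) ^+ n).

Definition cutoff : nat := Num.truncn (C / 10 * p * s%:R).
Local Notation M := cutoff.

Let p0 : 0 <= p. Proof. exact: ltW (regime_p_gt0 reg). Qed.
Let p1 : p <= 1. Proof. exact: ltW (regime_p_lt1 reg). Qed.

Lemma cutoff_itv : M%:R <= C / 10 * p * s%:R < M.+1%:R.
Proof.
apply: truncn_itv; rewrite !mulr_ge0 //; have := regime_C reg; lra.
Qed.

Lemma cutoff_le : (M <= s)%N.
Proof.
have /andP[h _] := cutoff_itv; rewrite -(ler_nat R); apply: le_trans h _.
have C0 := regime_C reg; have h := p_small reg.
have : C / 10 * p <= 1 by have := regime_p_gt0 reg; move: h; rewrite -mulrA; lra.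
by move=> h'; rewrite ler_piMl.
Qed.

Lemma phi_lower : (6 * C * p) ^+ k.-1 * k%:R * Num.sqrt L * Num.sqrt (n%:R * p) <= phi.
Proof.
have L8 := regime_L reg; have C0 := regime_C reg.
rewrite -(ler_pXn2r (n := 2)) ?nnegrE //; last 2 first.
- by rewrite !mulr_ge0 ?exprn_ge0 ?sqrtr_ge0 // !mulr_ge0 //; lra.
- exact: ltW (regime_phi0 reg).
apply: le_trans (p_upper reg); rewrite !exprMn !sqr_sqrtr ?mulr_ge0 //; last by lra.
rewrite mul2n -addnn !exprD -!expr2 -!exprMn.
by rewrite le_eqVlt; apply/orP; left; apply/eqP; ring.
Qed.

(** The mean is at least phi C(s,k)/2, twice the threshold. The gap contributes 15sL to the exponent
    and the variance takes back 2sL, leaving 13sL. *)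
Lemma survivors_failure S B : #|S| = s -> B \subset ~: S ->
  prob p (fun G => (('C(s, k)%:R / 2 : R) <= #|uncovered k S B G|%:R) &&
    (#|survivors M S B (uncovered k S B G) G|%:R <= phi * 'C(s, k)%:R / 4))
  <= expR (- (13 * (s%:R * L))).
Proof.
move=> Ss BS; have L8 := regime_L reg; have C0 := regime_C reg.
have pp := regime_p_gt0 reg; have s0 := regime_s reg; have n0 := regime_n reg.
have kr : 0 < k%:R :> R by rewrite ltr0n; exact: ltnW (k_gt1 reg).
have np0 : 0 < n%:R * p by rewrite mulr_gt0.
have Cp0 : 0 < C / 10 * p by rewrite mulr_gt0 //; lra.
have b0 : 0 < 'C(s, k)%:R :> R by rewrite ltr0n bin_gt0 (regime_ks reg).
(* With lambda = x/c the variance term is exactly 2sL, because x^2 n p = L; the condition on lambda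
   becomes x <= 1/2, that is np >= 4L. *)
pose x : R := Num.sqrt L / Num.sqrt (n%:R * p).
pose c : R := k%:R / s%:R * (C / 10 * p) ^+ k.-1 * 'C(s, k)%:R.
have c0 : 0 < c by rewrite !mulr_gt0 ?invr_gt0 ?exprn_gt0.
have r0 : 0 < Num.sqrt (n%:R * p) by rewrite sqrtr_gt0.
have l0 : 0 < Num.sqrt L by rewrite sqrtr_gt0; lra.
have x0 : 0 < x by rewrite divr_gt0.
have x2 : x ^+ 2 * (n%:R * p) = L.
  have L0 : 0 <= L by lra.
  by rewrite expr_div_n (sqr_sqrtr L0) (sqr_sqrtr (ltW np0)) divfK // gt_eqF.
have xle : x <= 1 / 2.
  have h4 : x ^+ 2 <= 1 / 4.
    rewrite -(ler_pM2r np0) x2; have := regime_np4L reg; lra.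
  case: (lerP x (1 / 2)) => // h; have : (1 / 2) * x < x * x by rewrite ltr_pM2r.
  rewrite expr2 in h4; lra.
have cM : 'C(M.-1, k.-1)%:R <= c.
  apply: bin_scale; rewrite ?cutoff_le ?(s_gt0 reg) //; first exact: ltnW (k_gt1 reg).
  by case/andP: cutoff_itv.
have lc : x / c * c = x by rewrite divfK // gt_eqF.
have xE : x = Num.sqrt L / Num.sqrt (n%:R * p) by [].
have cE : c = k%:R / s%:R * (C / 10 * p) ^+ k.-1 * 'C(s, k)%:R by [].
clearbody x c.
apply: le_trans (uncovered_survivors_tail (lam := x / c) p0 p1 _ _ (ltnW (k_gt1 reg)) BS _ cM _) _.
1,2: by rewrite ?lc // divr_ge0 // ltW.
rewrite ler_expR cardV Ss.
have -> : 2 * (x / c) ^+ 2 * p * (s%:R * n%:R * c ^+ 2) =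
    2 * s%:R * ((x / c * c) ^+ 2 * (n%:R * p)) :> R by ring.
rewrite lc x2.
have -> : x / c * (phi * 'C(s, k)%:R / 4) - x / c * (phi * ('C(s, k)%:R / 2)) =
   - (x * phi * 'C(s, k)%:R / c / 4) :> R.
  have c1 : c != 0 by rewrite gt_eqF.
  by move: (phi : R) ('C(s, k)%:R : R) => f b; field.
(* The upper bound on p enters here: 6Cp = 60 (C/10 p), and k >= 2 keeps at least one factor 60
   after raising to the power k-1. *)
have h60 : 60 * (k%:R * L * (C / 10 * p) ^+ k.-1) <= x * phi.
  apply: le_trans (ler_wpM2l (ltW x0) phi_lower).
  have -> : x * ((6 * C * p) ^+ k.-1 * k%:R * Num.sqrt L * Num.sqrt (n%:R * p)) =
     (6 * C * p) ^+ k.-1 * k%:R * (Num.sqrt L ^+ 2) :> R.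
    rewrite xE; move: ((6 * C * p) ^+ k.-1 : R) (k%:R : R) => u w.
    by move: (Num.sqrt L) (Num.sqrt _) r0 => a b r0; field; rewrite gt_eqF.
  rewrite sqr_sqrtr; last by lra.
  have -> : 6 * C * p = 60 * (C / 10 * p) :> R by field.
  rewrite [(60 * _) ^+ _]exprMn.
  have -> : 60 ^+ k.-1 * (C / 10 * p) ^+ k.-1 * k%:R * L =
    60 ^+ k.-1 * (k%:R * L * (C / 10 * p) ^+ k.-1) :> R.
    by ring.
  rewrite ler_wpM2r //; first by rewrite !mulr_ge0 ?exprn_ge0 ?(ltW Cp0) //; lra.
  rewrite -[leLHS]expr1 ler_weXn2l // ?ler1n //.
  by have := k_gt1 reg; case: (k) => // -[].
have h15 : 60 * (s%:R * L) <= x * phi * 'C(s, k)%:R / c.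
  rewrite ler_pdivlMr //.
  have -> : 60 * (s%:R * L) * c = 60 * (k%:R * L * (C / 10 * p) ^+ k.-1) * 'C(s, k)%:R :> R.
    rewrite cE; move: ((C / 10 * p) ^+ k.-1 : R) => u.
    by field; rewrite gt_eqF.
  by rewrite ler_wpM2r.
have : 0 <= s%:R * L by rewrite mulr_ge0 //; lra.
lra.
Qed.

Lemma clique_failure S : #|S| = s ->
  prob p (fun G => (phi * 'C(s, k)%:R / 4 <= #|uncovered k S (~: S) G|%:R) &&
     ~~ [exists K in uncovered k S (~: S) G, clique G K])
  <= expR (- (2 * (s%:R * L))).
Proof.
move=> Ss; have s0 := regime_s reg; have L8 := regime_L reg.
have f0 := regime_phi0 reg; have pp := regime_p_gt0 reg.
have b0 : 0 < 'C(s, k)%:R :> R by rewrite ltr0n bin_gt0 (regime_ks reg).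
apply: le_trans (uncovered_clique_tail p0 p1 (S := S) _ (k_gt1 reg) (overlap_ge1 reg) _) _.
  by rewrite Ss; exact: (overlap_sum reg).
rewrite ler_expR lerN2 /overlap.
have q0 : 0 < p ^+ 'C(k, 2) by rewrite exprn_gt0.
move: (p ^+ _) (phi) ('C(s, k)%:R) q0 f0 b0 => q f b q0 f0 b0.
rewrite le_eqVlt; apply/orP; left; apply/eqP; field.
by rewrite !gt_eqF //; lra.
Qed.

(* By [bin_tail], [expR (- degree_excess d)] bounds the probability that a vertex
   has [d > M] neighbours in [S]. *)
Definition degree_excess d : R := if (M < d)%N then d%:R * (ln (d%:R / (s%:R * p)) - 1) else 0.

Lemma excess_ge d : (M < d)%N -> C / 10 * p * s%:R < d%:R /\ 1 <= ln (d%:R / (s%:R * p)) - 1.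
Proof.
move=> Md; have L8 := regime_L reg; have C0 := regime_C reg.
have pp := regime_p_gt0 reg; have s0 := regime_s reg.
have /andP[_ h] := cutoff_itv.
have hd : C / 10 * p * s%:R < d%:R by apply: lt_le_trans h _; rewrite ler_nat.
split=> //; suff : 2 <= ln (d%:R / (s%:R * p)) by lra.
have d0 : 0 < d%:R / (s%:R * p).
  by rewrite divr_gt0 ?mulr_gt0 // ltr0n; apply: leq_ltn_trans Md.
rewrite -ler_expR lnK ?posrE //; have -> : (2 : R) = 1 + 1 by [].
rewrite expRD; apply: (@le_trans _ _ (4 * 4)).
  by apply: ler_pM; rewrite ?expR_ge0 ?expR1_le4.
rewrite ler_pdivlMr ?mulr_gt0 //; apply: le_trans (ltW hd).
have -> : C / 10 * p * s%:R = C / 10 * (s%:R * p) by ring.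
rewrite ler_wpM2r ?mulr_ge0 ?(ltW pp) //; lra.
Qed.

Lemma one_plus_inv_pow (m : nat) : (0 < m)%N -> (1 + m%:R^-1) ^+ m <= expR 1 :> R.
Proof.
move=> m0; have mr : 0 < m%:R :> R by rewrite ltr0n.
have -> : expR 1 = expR (m%:R^-1) ^+ m :> R by rewrite -expRM_natl mulfV // gt_eqF.
by rewrite lerXn2r ?nnegrE ?expR_ge0 ?expR_ge1Dx // addr_ge0 // invr_ge0 ltW.
Qed.

(** [bin_tail] gives e^(-excess), so e^(excess/2) leaves e^(-excess/2) <= n^(-4): an excess is at
    least its degree, which exceeds 8 log n. The s+1 terms sum to at most 1/n, and (1+1/n)^n <= e is
    the 1 in the exponent. *)
Lemma excess_failure S : #|S| = s ->
  prob p (fun G => 4 * (s%:R * L) <= \sum_(v in ~: S) degree_excess #|nbr G v :&: S|)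
  <= expR (1 - 2 * (s%:R * L)).
Proof.
move=> Ss; have L8 := regime_L reg; have C0 := regime_C reg.
have pp := regime_p_gt0 reg; have s0 := regime_s reg; have n0 := regime_n reg.
have n1 : (0 < n)%N by rewrite -(ltr0n R).
apply: le_trans (heavy_tail p0 p1 (M := M) (delta := n%:R^-1) _ _ _ _) _.
- by move=> d dM; rewrite /degree_excess ltnNge dM.
- by rewrite invr_ge0.
- rewrite Ss; apply: (@le_trans _ _ (\sum_(j < s.+1) expR (- (4 * ln n%:R)))).
    rewrite big_mkcond; apply: ler_sum => j _; case: ifP => Mj; last exact: expR_ge0.
    have [h1 h2] := excess_ge Mj; have j0 : (0 < j)%N by exact: leq_ltn_trans Mj.
    have jr : 0 < j%:R :> R by rewrite ltr0n.
    rewrite mulrA; apply: le_trans (ler_wpM2r (expR_ge0 _) (bin_tail pp j0 (s_gt0 reg))) _.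
    rewrite -expRD ler_expR /degree_excess Mj.
    have h3 : j%:R * 1 <= j%:R * (ln (j%:R / (s%:R * p)) - 1) by rewrite ler_wpM2l.
    suff : 8 * ln n%:R <= j%:R :> R by lra.
    have h4 := regime_splogn reg; have h5 := regime_ln_n reg.
    have h6 : 1000 * (s%:R * p) <= j%:R.
      apply: le_trans (ltW h1).
      have -> : C / 10 * p * s%:R = C / 10 * (s%:R * p) by ring.
      by rewrite ler_wpM2r ?mulr_ge0 //; lra.
    have hC : 1000 <= C ^+ 2.
      rewrite expr2; have : 1000 * 1 <= C * C by apply: ler_pM; lra.
      lra.
    have h7 : 1000 / 4 * ln n%:R <= C ^+ 2 / 4 * ln n%:R by rewrite ler_wpM2r //; lra.
    lra.
  rewrite sumr_const card_ord -[leLHS]mulr_natl expRN.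
  have -> : expR (4 * ln n%:R) = n%:R ^+ 4 :> R.
    by rewrite (expRM_natl 4) lnK.
  rewrite ler_pdivrMr ?exprn_gt0 // exprS mulKf ?gt_eqF // -natrX ler_nat.
  have := s_le_n reg; have := n_ge2 reg; rewrite !expnS expn0; nia.
rewrite cardV; apply: le_trans (ler_wpM2l (expR_ge0 _) (one_plus_inv_pow n1)) _.
rewrite -expRD ler_expR; lra.
Qed.

Lemma degree_failure :
  prob p (fun G => [exists v, 16 * (n%:R * p) < #|nbr G v|%:R])
  <= n%:R * expR (- (16 * (n%:R * p))).
Proof.
have pp := regime_p_gt0 reg; have n0 := regime_n reg.
have np0 : 0 < n%:R * p by rewrite mulr_gt0.
pose j := (Num.truncn (16 * (n%:R * p))).+1.
have jgt : 16 * (n%:R * p) < j%:R by exact: truncnS_gt.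
apply: (@le_trans _ _ (\sum_(v in V) expR (- (16 * (n%:R * p))))); last first.
  by rewrite sumr_const cardV -[leLHS]mulr_natl.
apply: (@le_trans _ _ (prob p (fun G => [exists v, (v \in V) && (j <= #|nbr G v|)%N]))).
  apply: prob_sub => // G /existsP[v hv]; apply/existsP; exists v.
  by rewrite inE /= /j truncn_lt_nat // mulr_ge0 // ltW.
apply: le_trans (prob_exists p0 p1 _ _) _.
apply: ler_sum => v _; apply: le_trans (degree_tail p0 p1 v j) _.
rewrite cardV; apply: (@le_trans _ _ ('C(n, j)%:R * p ^+ j)).
  by rewrite ler_wpM2r ?exprn_ge0 // ler_nat leq_bin2l // leq_pred.
apply: le_trans (bin_tail pp _ _) _ => //; first by rewrite -(ltr0n R).
rewrite ler_expR lerN2.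
have jr : 0 < j%:R :> R by rewrite ltr0n.
have h2 : 2 <= ln (j%:R / (n%:R * p)).
  rewrite -ler_expR lnK ?posrE ?divr_gt0 //; have -> : (2 : R) = 1 + 1 by [].
  rewrite expRD; apply: (@le_trans _ _ (4 * 4)).
    by apply: ler_pM; rewrite ?expR_ge0 ?expR1_le4.
  rewrite ler_pdivlMr //; lra.
have : j%:R * 1 <= j%:R * (ln (j%:R / (n%:R * p)) - 1) by rewrite ler_wpM2l //; lra.
lra.
Qed.

End FailureProbabilities.

(** floor(n/q)+1 is the least size above n/q: with m < q colours, m floor(n/q) <= m n/q < n, so the
    pigeonhole principle applies. *)
Lemma few_colors_class (R : realType) (V : finType) (G : graph V) (q : R) k : 0 < q -> (1 < k)%N ->
  (clique_chromatic_number G)%:R < q -> (0 < #|V|)%N ->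
  exists2 S : {set V}, #|S| = (Num.truncn (#|V|%:R / q)).+1 &
    forall K : {set V}, K \subset S -> #|K| = k -> clique G K ->
      exists2 v, v \notin S & K \subset nbr G v.
Proof.
move=> q0 k1; rewrite /clique_chromatic_number; case: ex_minnP => m hm _ mq V0.
have n0 : 0 < #|V|%:R :> R by rewrite ltr0n.
apply: (coloring_class hm) => //=; rewrite -(ltr_nat R) natrM.
have h : (Num.truncn (#|V|%:R / q))%:R <= #|V|%:R / q.
  by have /andP[] := truncn_itv (x := #|V|%:R / q) (divr_ge0 (ltW n0) (ltW q0)).
apply: (@le_lt_trans _ _ (m%:R * (#|V|%:R / q))); first by rewrite ler_wpM2l.
by rewrite mulrCA gtr_pMr // ltr_pdivrMr // mul1r.
Qed.

(** * Heavy vertices and the union bound *)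

Section Assembly.
Context {R : realType} {V : finType}.
Variables (C p L : R) (n k s : nat).
Hypothesis reg : regime C p L n k s.
Hypothesis cardV : #|V| = n.
Implicit Types (G : graph V) (S K B : {set V}).
Local Notation phi := ((1 - p ^+ k) ^+ n).
Local Notation M := (cutoff C p s).
Local Notation excess := (degree_excess C p s).

Let p0 : 0 <= p. Proof. exact: ltW (regime_p_gt0 reg). Qed.
Let p1 : p <= 1. Proof. exact: ltW (regime_p_lt1 reg). Qed.

Definition heavy S G := [set v in ~: S | (M < #|nbr G v :&: S|)%N].

Lemma heavyS S G : heavy S G \subset ~: S.
Proof. by apply/fintype.subsetP => v; rewrite in_set => /andP[]. Qed.

Lemma excess_ge0 d : 0 <= excess d.
Proof.
rewrite /degree_excess; case: ifP => // Md; have [_ h] := excess_ge reg Md.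
by rewrite mulr_ge0 //; lra.
Qed.

(** Each heavy vertex has excess at least its degree, hence above C/10 p s. *)
Lemma card_heavy S G : \sum_(v in ~: S) excess #|nbr G v :&: S| < 4 * (s%:R * L) ->
  #|heavy S G|%:R <= 40 * L / (C * p).
Proof.
move=> h; have L8 := regime_L reg; have C0 := regime_C reg.
have pp := regime_p_gt0 reg; have s0 := regime_s reg.
have Cp0 : 0 < C * p by rewrite mulr_gt0 //; lra.
rewrite ler_pdivlMr //.
have h1 : #|heavy S G|%:R * (C / 10 * p * s%:R) <=
    \sum_(v in ~: S) excess #|nbr G v :&: S|.
  rewrite mulr_natl -sumr_const big_mkcond [leRHS]big_mkcond; apply: ler_sum => v _.
  rewrite in_set; case: (boolP (v \in ~: S)) => //= vS.
  case: ifP => Mv; last exact: excess_ge0.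
  have [h1 h2] := excess_ge reg Mv; rewrite /degree_excess Mv.
  apply: le_trans (ltW h1) _; rewrite ler_peMr //.
have h2 : (#|heavy S G|%:R * (C * p)) * s%:R <= (40 * L) * s%:R.
  move: (le_lt_trans h1 h); have -> : #|heavy S G|%:R * (C / 10 * p * s%:R) =
     #|heavy S G|%:R * (C * p) * s%:R / 10 :> R by field.
  lra.
by rewrite ler_pM2r in h2.
Qed.

(** With y = d/s, C(d,k) <= y^k C(s,k) <= y^2 C(s,k), and [bad_degree_ineq] trades one factor y for
    the logarithm in the excess. The bound 16np on degrees and [s_degree] give the required y <=
    16/C^2. *)
Lemma bin_excess d : (d <= s)%N -> d%:R <= 16 * (n%:R * p) -> (M < d)%N ->
  'C(d, k)%:R <= 'C(s, k)%:R * (excess d / (8 * (s%:R * L))).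
Proof.
move=> ds dn Md; have L8 := regime_L reg; have C0 := regime_C reg.
have pp := regime_p_gt0 reg; have s0 := regime_s reg.
have [h1 h2] := excess_ge reg Md.
have d0 : (0 < d)%N by exact: leq_ltn_trans Md.
have dr : 0 < d%:R :> R by rewrite ltr0n.
have k0 : (0 < k)%N by exact: ltnW (k_gt1 reg).
have kr : 0 < k%:R :> R by rewrite ltr0n.
pose y : R := d%:R / s%:R.
have y0 : 0 < y by rewrite divr_gt0.
have y1 : y <= 1 by rewrite ler_pdivrMr // mul1r ler_nat.
have e1 : 'C(d, k)%:R <= 'C(s, k)%:R * y ^+ k :> R.
  have hb := bin_scale k0 (s_gt0 reg) ds (r := y).
  have {hb} : 'C(d.-1, k.-1)%:R <= k%:R / s%:R * y ^+ k.-1 * 'C(s, k)%:R :> R.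
    by apply: hb; rewrite /y divfK // gt_eqF.
  move=> hb; rewrite -(ler_pM2l kr).
  have -> : k%:R * 'C(d, k)%:R = d%:R * 'C(d.-1, k.-1)%:R :> R.
    by rewrite -!natrM mul_bin_diag prednK.
  apply: le_trans (ler_wpM2l (ltW dr) hb) _.
  have -> : y ^+ k = y * y ^+ k.-1 by rewrite -exprS prednK.
  rewrite le_eqVlt; apply/orP; left; apply/eqP; rewrite {2}/y.
  by move: ('C(s, k)%:R : R) (y ^+ _) => a b; field; rewrite gt_eqF.
apply: le_trans e1 _; rewrite ler_wpM2l //.
have sL : 0 < 8 * (s%:R * L) by rewrite !mulr_gt0 //; lra.
rewrite ler_pdivlMr //.
apply: (@le_trans _ _ (y ^+ 2 * (8 * (s%:R * L)))).
  by rewrite ler_wpM2r ?(ltW sL) // ler_wiXn2l ?(ltW y0) // (k_gt1 reg).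
have yC : y <= 16 / C ^+ 2.
  rewrite ler_pdivrMr // mulrAC ler_pdivlMr; last by rewrite exprn_gt0 //; lra.
  apply: le_trans (_ : 16 * (n%:R * p) * C ^+ 2 <= _).
    by rewrite ler_wpM2r // sqr_ge0.
  by have := s_degree reg; rewrite -mulrA [_ * C ^+ 2]mulrC; lra.
have yl : C / 10 * p < y by rewrite ltr_pdivlMr.
have hy := bad_degree_ineq reg yl yC.
rewrite /degree_excess Md.
have -> : y ^+ 2 * (8 * (s%:R * L)) = d%:R * (8 * L * y) by rewrite expr2 /y; field; rewrite gt_eqF.
rewrite ler_wpM2l // (le_trans hy) //.
have -> : d%:R / (s%:R * p) = y * expR L.
  by rewrite /y (pE reg) expRN invfM invrK; ring.
rewrite lnM ?posrE ?expR_gt0 // expRK; lra.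
Qed.

(** Summing [bin_excess] over the heavy vertices, a total excess below 4sL covers at most the
    fraction 4sL/(8sL) = 1/2 of the k-subsets. *)
Lemma card_uncovered_heavy S G : #|S| = s ->
  (forall v, #|nbr G v|%:R <= 16 * (n%:R * p)) ->
  \sum_(v in ~: S) excess #|nbr G v :&: S| < 4 * (s%:R * L) ->
  'C(s, k)%:R / 2 <= #|uncovered k S (heavy S G) G|%:R :> R.
Proof.
move=> Ss hdeg hex; have L8 := regime_L reg; have s0 := regime_s reg.
have sL : 0 < s%:R * L by rewrite mulr_gt0 //; lra.
set U := uncovered _ _ _ _.
pose cov v := [set K : {set V} | (K \subset nbr G v :&: S) && (#|K| == k)].
have sub : ksets k S :\: U \subset \bigcup_(v in heavy S G) cov v.
  apply/fintype.subsetP => K; rewrite in_setD in_set => /andP[+ Kk].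
  rewrite Kk /= negb_forall_in => /exists_inP[v vB]; rewrite negbK => Kv.
  apply/bigcupP; exists v => //; move: Kk; rewrite !in_set subsetI Kv.
  by move=> /andP[-> ->].
have h1 : (#|ksets k S :\: U| <= \sum_(v in heavy S G) 'C(#|nbr G v :&: S|, k))%N.
  apply: leq_trans (subset_leq_card sub) _.
  elim/big_ind2: _ => [|m A m' A' h h'|v _]; first by rewrite cards0.
    exact: leq_trans (leq_card_setU _ _) (leq_add h h').
  by rewrite cards_draws.
have h2 : #|ksets k S :\: U|%:R <= 'C(s, k)%:R / 2 :> R.
  apply: (@le_trans _ _ (\sum_(v in heavy S G) 'C(#|nbr G v :&: S|, k)%:R)).
    by rewrite -natr_sum ler_nat.
  apply: (@le_trans _ _ (\sum_(v in ~: S) 'C(s, k)%:R *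
      (excess #|nbr G v :&: S| / (8 * (s%:R * L))))).
    rewrite big_mkcond [leRHS]big_mkcond; apply: ler_sum => v _.
    rewrite in_set; case: (v \in ~: S) => //=; case: ifP => Mv; last first.
      by rewrite mulr_ge0 // divr_ge0 ?excess_ge0 // mulr_ge0 // ltW.
    apply: bin_excess => //.
      by rewrite -Ss subset_leq_card // finset.subsetIr.
    apply: le_trans (hdeg v); rewrite ler_nat subset_leq_card //; exact: finset.subsetIl.
  rewrite -mulr_sumr -mulr_suml ler_wpM2l // ler_pdivrMr; last by rewrite mulr_gt0.
  lra.
have h3 : 'C(s, k)%:R = #|U|%:R + #|ksets k S :\: U|%:R :> R.
  have -> : 'C(s, k) = #|ksets k S| by rewrite -Ss -cards_draws.
  rewrite -[in LHS](cardsID U) natrD; congr (_%:R + _).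
  by have /setIidPr -> := uncoveredS k S (heavy S G) G.
lra.
Qed.

Definition spread G := [forall S : {set V}, (#|S| == s) ==>
  [exists K in uncovered k S (~: S) G, clique G K]].

Let b : R := 40 * L / (C * p).

Lemma spread_criterion G : (forall v, #|nbr G v|%:R <= 16 * (n%:R * p)) ->
  (forall S, #|S| = s ->
    [/\ \sum_(v in ~: S) excess #|nbr G v :&: S| < 4 * (s%:R * L),
     forall B, B \subset ~: S -> #|B|%:R <= b ->
       ~~ ((('C(s, k)%:R / 2 : R) <= #|uncovered k S B G|%:R) &&
       (#|survivors M S B (uncovered k S B G) G|%:R <= phi * 'C(s, k)%:R / 4)) &
     ~~ ((phi * 'C(s, k)%:R / 4 <= #|uncovered k S (~: S) G|%:R) &&
     ~~ [exists K in uncovered k S (~: S) G, clique G K])]) -> spread G.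
Proof.
move=> hdeg H; apply/forallP => S; apply/implyP => /eqP Ss.
have [h1 h2 h3] := H S Ss.
have := h2 _ (heavyS S G) (card_heavy h1).
rewrite card_uncovered_heavy //= -ltNge => hs.
move: h3; rewrite negb_and negbK => /orP[|//]; rewrite -ltNge => hu.
have := lt_trans hu hs; rewrite ltr_nat ltnNge => /negP[].
apply: subset_leq_card; apply/fintype.subsetP => K; rewrite in_set => /andP[KU /forall_inP hK].
move: (KU); rewrite in_set => /andP[Kk /forall_inP hB].
rewrite in_set Kk /=; apply/forall_inP => v vS.
case: (boolP (v \in heavy S G)) => vB; first exact: hB.
have := hK v; rewrite in_setC in_setU negb_or vB andbT -in_setC => /(_ vS).
apply: contra => Kv; rewrite trunc_id.
  by rewrite subsetI Kv; move: Kk; rewrite in_set => /andP[].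
by move: vB; rewrite in_set vS /= -leqNgt.
Qed.

(** C(n,s) <= (en/s)^s, and s/n >= C^2 p >= e^2 p. The spare e^(-s) is what makes the final union
    bound vanish. *)
Lemma card_choices : 'C(n, s)%:R <= expR (s%:R * L - s%:R) :> R.
Proof.
have L8 := regime_L reg; have C0 := regime_C reg.
have pp := regime_p_gt0 reg; have s0 := regime_s reg; have n0 := regime_n reg.
have sn : 0 < s%:R / n%:R :> R by rewrite divr_gt0.
have h := bin_entropy (R := R) n s.
rewrite -ler_pdivlMr ?exprn_gt0 // in h.
apply: le_trans h _; rewrite ler_pdivrMr ?exprn_gt0 //.
have h2 : expR 2 * p <= s%:R / n%:R.
  rewrite ler_pdivlMr //; apply: le_trans (s_degree reg).
  have -> : expR 2 * p * n%:R = expR 2 * (n%:R * p) by ring.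
  rewrite ler_wpM2r ?mulr_ge0 //.
  have -> : (2 : R) = 1 + 1 by [].
  rewrite expRD; apply: (@le_trans _ _ (4 * 4)).
    by apply: ler_pM; rewrite ?expR_ge0 ?expR1_le4.
  rewrite expr2; have : 16 * 1 <= C * C by apply: ler_pM; lra.
  lra.
apply: (@le_trans _ _ (expR (s%:R * L - s%:R) * (expR 2 * p) ^+ s)); last first.
  by rewrite ler_wpM2l ?expR_ge0 // lerXn2r ?nnegrE ?mulr_ge0 ?expR_ge0 // ltW.
rewrite (pE reg) -expRD -expRM_natl -expRD ler_expR; lra.
Qed.

Lemma card_choices_heavy : #|[set B : {set V} | #|B|%:R <= b]|%:R <= expR (1 + s%:R * L).
Proof.
have L8 := regime_L reg; have C0 := regime_C reg.
have pp := regime_p_gt0 reg; have s0 := regime_s reg; have l0 := regime_ln_n reg.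
apply: le_trans (card_small_sets _ _) _; first by rewrite cardV (n_ge2 reg).
rewrite ler_expR lerD2l cardV.
have Cp0 : 0 < C * p by rewrite mulr_gt0 //; lra.
rewrite /b mulrAC ler_pdivrMr //.
have h := regime_splogn reg.
have hC : 1000 <= C ^+ 2.
  rewrite expr2; have : 1000 * 1 <= C * C by apply: ler_pM; lra.
  lra.
have h1 : 1000 / 4 * ln n%:R <= C ^+ 2 / 4 * ln n%:R by rewrite ler_wpM2r //; lra.
have sp0 : 0 <= s%:R * p by rewrite mulr_ge0.
have h2 : 40 * ln n%:R <= s%:R * p by lra.
have h3 : s%:R * p <= C * (s%:R * p) by rewrite ler_peMl //; lra.
have -> : 40 * L * ln n%:R = L * (40 * ln n%:R) by ring.
have -> : s%:R * L * (C * p) = L * (C * (s%:R * p)) by ring.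
by rewrite ler_wpM2l //; lra.
Qed.

(** Three bounds e^(1-2sL) times e^(sL-s) choices of [S] give at most 12e^(-s), using e <= 4. Since
    s >= np >= 4 log n, this is at most 12/n; the degree event adds the thirteenth 1/n. *)
Lemma spread_failure : prob p (fun G => ~~ spread G) <= 13 / n%:R.
Proof.
have L8 := regime_L reg; have C0 := regime_C reg.
have pp := regime_p_gt0 reg; have s0 := regime_s reg; have n0 := regime_n reg.
have np0 : 0 < n%:R * p by rewrite mulr_gt0.
pose E0 G := [exists v, 16 * (n%:R * p) < #|nbr G v|%:R].
pose E1 S B G := (('C(s, k)%:R / 2 : R) <= #|uncovered k S B G|%:R) &&
       (#|survivors M S B (uncovered k S B G) G|%:R <= phi * 'C(s, k)%:R / 4).
pose E2 S G := (phi * 'C(s, k)%:R / 4 <= #|uncovered k S (~: S) G|%:R) &&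
     ~~ [exists K in uncovered k S (~: S) G, clique G K].
pose E3 S G := 4 * (s%:R * L) <= \sum_(v in ~: S) excess #|nbr G v :&: S|.
pose QB S B := (B \subset ~: S) && (#|B|%:R <= b).
pose E4 S G := E3 S G || ([exists B, QB S B && E1 S B G] || E2 S G).
have step : prob p (fun G => ~~ spread G) <=
    prob p (fun G => E0 G || [exists S : {set V}, (#|S| == s) && E4 S G]).
  apply: prob_sub => // G; apply: contraR; rewrite negb_or => /andP[nE0 nE4].
  apply: spread_criterion => [v|S Ss].
    by move: nE0; rewrite negb_exists => /forallP/(_ v); rewrite -leNgt.
  move: nE4; rewrite negb_exists => /forallP/(_ S); rewrite Ss eqxx /= !negb_or.
  case/and3P=> h3 h1 h2; split=> //; first by rewrite ltNge.
  move=> B BS Bb; move: h1; rewrite negb_exists => /forallP/(_ B).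
  by rewrite /QB BS Bb.
apply: le_trans step _; apply: le_trans (prob_or p0 p1 _ _) _.
have hE4 S : #|S| == s -> prob p (E4 S) <= expR (1 - 2 * (s%:R * L)) * 3.
  move=> /eqP Ss; apply: le_trans (prob_or p0 p1 _ _) _.
  have P3 := excess_failure reg cardV Ss.
  have P2 := clique_failure reg Ss.
  have P1 : prob p (fun G => [exists B, QB S B && E1 S B G]) <=
      expR (1 - 12 * (s%:R * L)).
    apply: le_trans (prob_exists p0 p1 _ _) _.
    apply: (@le_trans _ _ (\sum_(B | QB S B) expR (- (13 * (s%:R * L))))).
      by apply: ler_sum => B /andP[BS _]; exact: (survivors_failure reg cardV Ss BS).
    rewrite sumr_const -[leLHS]mulr_natl.
    apply: (@le_trans _ _ (expR (1 + s%:R * L) * expR (- (13 * (s%:R * L))))).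
      rewrite ler_wpM2r ?expR_ge0 //; apply: le_trans card_choices_heavy.
      rewrite ler_nat subset_leq_card //; apply/fintype.subsetP => B.
      by rewrite in_set => /andP[].
    rewrite -expRD ler_expR; lra.
  have P12 := prob_or p0 p1 (fun G => [exists B, QB S B && E1 S B G]) (E2 S).
  have sL : 0 <= s%:R * L by rewrite mulr_ge0 //; lra.
  have g1 : expR (1 - 12 * (s%:R * L)) <= expR (1 - 2 * (s%:R * L)).
    by rewrite ler_expR; lra.
  have g2 : expR (- (2 * (s%:R * L))) <= expR (1 - 2 * (s%:R * L)).
    by rewrite ler_expR; lra.
  rewrite -/(E3 S) -/(E2 S) in P3 P2 *; lra.
have hS : prob p (fun G => [exists S : {set V}, (#|S| == s) && E4 S G]) <= 12 * expR (- s%:R).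
  apply: le_trans (prob_exists p0 p1 _ _) _.
  apply: le_trans (ler_sum _ hE4) _.
  rewrite sumr_const -[leLHS]mulr_natl.
  have -> : #|[pred S : {set V} | #|S| == s]| = 'C(n, s).
    rewrite -cardV -[in RHS]finset.cardsT -cards_draws -cardsE.
    by apply: eq_card => S; rewrite !in_set finset.subsetT.
  have q0 : 0 <= expR (1 - 2 * (s%:R * L)) * 3 :> R by rewrite mulr_ge0 ?expR_ge0.
  apply: le_trans (ler_wpM2r q0 card_choices) _; rewrite [leLHS]mulrA -expRD.
  have sL : 0 <= s%:R * L by rewrite mulr_ge0 //; lra.
  have : expR (s%:R * L - s%:R + (1 - 2 * (s%:R * L))) <= expR 1 * expR (- s%:R).
    by rewrite -expRD ler_expR; lra.
  have : expR 1 * expR (- s%:R) <= 4 * expR (- s%:R) :> R.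
    by rewrite ler_wpM2r ?expR_ge0 // expR1_le4.
  lra.
have lnn := np_large reg.
have hs4 : expR (- s%:R) <= expR (- (4 * ln n%:R)) :> R.
  rewrite ler_expR lerN2; apply: le_trans lnn _; apply: le_trans (s_degree reg).
  rewrite ler_peMl ?(ltW np0) // expr2; have : 1 * 1 <= C * C by apply: ler_pM; lra.
  lra.
have h0 : n%:R * expR (- (16 * (n%:R * p))) <= n%:R * expR (- (4 * ln n%:R)).
  rewrite ler_wpM2l // ler_expR lerN2; lra.
have e4 : expR (- (4 * ln n%:R)) = (n%:R ^+ 4)^-1 :> R by rewrite expRN (expRM_natl 4) lnK.
have nn1 : 1 <= n%:R :> R by rewrite ler1n; have := n_ge2 reg; case: (n).
have h4 : n%:R * expR (- (4 * ln n%:R)) <= n%:R^-1 :> R.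
  rewrite e4 exprS invfM mulrA divff ?gt_eqF // mul1r lef_pV2 ?posrE ?exprn_gt0 //.
  by rewrite -[leLHS]expr1 ler_weXn2l.
have h5 : expR (- (4 * ln n%:R)) <= n%:R * expR (- (4 * ln n%:R)) :> R.
  by rewrite ler_peMl ?expR_ge0.
have P0 := degree_failure reg cardV; rewrite -/E0 in P0.
lra.
Qed.

Lemma spread_chromatic G (q : R) : 0 < q -> s = (Num.truncn (n%:R / q)).+1 ->
  spread G -> q <= (clique_chromatic_number G)%:R.
Proof.
move=> q0 Es /forallP spG; rewrite leNgt; apply/negP => Gq.
have V0 : (0 < #|V|)%N by rewrite cardV; apply: leq_trans (n_ge2 reg).
have [S] := few_colors_class q0 (k_gt1 reg) Gq V0; rewrite cardV -Es => Ss HS.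
have := spG S; rewrite Ss eqxx /= => /exists_inP[K]; rewrite in_set => /andP[].
rewrite in_set => /andP[KS /eqP Kk] /forall_inP nc Kc.
have [v vS Kv] := HS K KS Kk Kc; have := nc v; rewrite in_setC vS => /(_ isT).
by rewrite Kv.
Qed.

End Assembly.

(** * The theorem *)

Section FixedSize.
Context {R : realType}.
Implicit Types (p q L : R) (n k : nat).

Lemma Gnp_probE n p (A : pred (graph 'I_n)) : Gnp_prob p A = prob p A.
Proof.
rewrite /Gnp_prob big_mkcond; apply: eq_bigr => G _.
by case: (A G); rewrite ?mulr1 ?mulr0.
Qed.

Lemma exprn_powR (x y : R) (m : nat) : 0 <= x -> (x `^ (y / m.+1%:R)) ^+ m.+1 = x `^ y.
Proof.
move=> x0; rewrite -powR_mulrn ?powR_ge0 // -powRrM; congr (_ `^ _).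
by rewrite divfK // pnatr_eq0.
Qed.

Lemma chromatic_bound (C p : R) n k : C = 32 ^+ 4 -> (2 <= n)%N -> (2 <= k)%N ->
  0 < p <= 1 -> 4 * ln n%:R <= n%:R * p -> 1 <= n%:R * p ->
  p <= (6 * C)^-1 * (k%:R ^+ 2 * ln (1 / p) * (n%:R * p))
                `^ (- (1 / (2 * (k%:R - 1))))
            * (1 - p ^+ k) `^ (n%:R / (k%:R - 1)) ->
  (3 <= k)%N%:R * k%:R ^+ 5 * ln (1 / p)
       <= Num.max (n%:R * p ^+ 2) (p `^ (- ((k%:R - 2) / 2)))
            * (1 - p ^+ k) `^ (n%:R * (k%:R - 2) / (k%:R - 1)) ->
  1 - 13 / n%:R <= Gnp_prob p (fun G : graph 'I_n =>
      1 / C ^+ 2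
        * Num.min (1 / p)
            (p `^ (k%:R / 2) * n%:R
             / ((k`!)%:R * k%:R * ln (1 / p)) `^ (1 / (k%:R - 1)))
        * (1 - p ^+ k) `^ (n%:R / (k%:R - 1))
      <= (clique_chromatic_number G)%:R).
Proof.
move=> CE n2 k2 /andP[p0 p1] np4 np1.
case: k k2 => [//|m] m1; have {m1} : (0 < m)%N by [].
case: m => // m _; set k := m.+2.
have -> : k%:R - 1 = m.+1%:R :> R by rewrite /k -[m.+2%:R]natr1 addrK.
have mr : 0 < m.+1%:R :> R by rewrite ltr0n.
have kr : 0 < k%:R :> R by rewrite ltr0n.
have nr : 0 < n%:R :> R by rewrite ltr0n; lia.
have CC : 1000 * 1000 <= C by rewrite CE !exprS expr0; lra.
have n0 : (0 < n)%N by lia.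
set L := ln (1 / p).
have pL : p = expR (- L) by rewrite /L div1r lnV ?posrE // opprK lnK.
have powpos (x y : R) : 0 < x -> 0 < x `^ y by exact: powR_gt0.
(* At p = 1 the factor (1-p^k) to a positive power is 0, so the claimed bound is 0. *)
case: (eqVneq p 1) => [E|pn1].
  rewrite E expr1n subrr powR0 ?mulr0 ?ler10 //.
  by rewrite mulf_neq0 ?invr_eq0 ?gt_eqF.
have pl1 : p < 1 by rewrite lt_neqAle pn1.
have L0 : 0 < L by rewrite -oppr_lt0 -expR_lt1 -pL.
set a := 1 - p ^+ k; have a0 : 0 < a by rewrite subr_gt0 exprn_ilt1 ?ltW.
have a1 : a <= 1 by rewrite lerBlDr lerDl exprn_ge0 // ltW.
set psi := a `^ (n%:R / m.+1%:R).
have psi0 : 0 < psi by exact: powpos.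
have psim : psi ^+ m.+1 = a ^+ n by rewrite exprn_powR ?powR_mulrn ?ltW.
have psi1 : psi <= 1.
  have : psi ^+ m.+1 <= 1 by rewrite psim exprn_ile1 // ltW.
  by rewrite expr_le1 // ltW.
set T := k%:R ^+ 2 * L * (n%:R * p).
have T0 : 0 < T by rewrite !mulr_gt0 ?exprn_gt0.
set theta := T `^ (- (1 / (2 * m.+1%:R))).
have theta0 : 0 < theta by exact: powpos.
have thetam : theta ^+ (2 * m.+1) = T^-1.
  rewrite /theta powRN exprVn; congr (_^-1).
  rewrite -natrM mul2n -addnn addSn exprn_powR ?powRr1 //; exact: ltW.
move=> hyp2 hyp3.
have upper : (6 * C * p) ^+ (2 * m.+1) * T <= (a ^+ n) ^+ 2.
  have h : 6 * C * p <= theta * psi.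
    rewrite -ler_pdivlMl; last by lra.
    by rewrite mulrA.
  have C6p : 0 <= 6 * C * p by rewrite !mulr_ge0 ?(ltW p0) //; lra.
  have tp0 : 0 <= theta * psi by rewrite ltW // mulr_gt0.
  have := lerXn2r (2 * m.+1) C6p tp0 h.
  have psi2 : psi ^+ (2 * m.+1) = (a ^+ n) ^+ 2 by rewrite mulnC exprM psim.
  rewrite [leRHS]exprMn thetam psi2 => h2.
  by rewrite -ler_pdivlMr // [leRHS]mulrC.
(* This excludes p close to 1, where L tends to 0. Since (1-p^k)^(2n) <= 1 - e^(-kL) <= kL, one
   factor kL cancels from [upper], and k n p >= 1 finishes. *)
have small : 6 * C * p <= 1.
  have aL : (a ^+ n) ^+ 2 <= k%:R * L.
    apply: (@le_trans _ _ a).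
      rewrite -exprM -[leRHS]expr1 ler_wiXn2l ?(ltW a0) // muln_gt0 n0 //.
    rewrite /a pL -expRM_natl mulrN; have := expR_ge1Dx (- (k%:R * L)); lra.
  have h := le_trans upper aL.
  have h2 : (6 * C * p) ^+ (2 * m.+1) * (k%:R * (n%:R * p)) <= 1.
    rewrite -(ler_pM2r (mulr_gt0 kr L0)) mul1r; apply: le_trans h.
    by rewrite /T le_eqVlt; apply/orP; left; apply/eqP; ring.
  have C6p : 0 <= 6 * C * p by rewrite !mulr_ge0 ?(ltW p0) //; lra.
  have h3 : (6 * C * p) ^+ (2 * m.+1) <= 1.
    apply: le_trans h2; rewrite ler_peMr ?exprn_ge0 //.
    have : 1 * 1 <= k%:R * (n%:R * p) by apply: ler_pM => //; rewrite ler1n.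
    by rewrite mul1r.
  by rewrite expr_le1 in h3.
have L1 : 1 <= L.
  rewrite -ler_expR; apply: le_trans expR1_le4 _.
  rewrite pL expRN ler_pdivrMr ?expR_gt0 // mul1r in small; lra.
set Q := (k`!%:R * k%:R * L) `^ (1 / m.+1%:R).
have W0 : 0 < k`!%:R * k%:R * L by rewrite !mulr_gt0 // ltr0n fact_gt0.
have Q0 : 0 < Q by exact: powpos.
have Qm : Q ^+ m.+1 = k`!%:R * k%:R * L by rewrite exprn_powR ?powRr1 // ltW.
have Q1 : 1 <= Q.
  have W1 : 1 <= k`!%:R * k%:R * L.
    rewrite -natrM; have : 1 * 1 <= (k`! * k)%:R * L.
      by apply: ler_pM => //; rewrite ler1n muln_gt0 fact_gt0.
    by rewrite mul1r.
  by rewrite -(@ler_pXn2r _ m.+1) ?nnegrE ?(ltW Q0) // expr1n Qm.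
set A := Num.min _ _.
have A1 : A <= 1 / p by rewrite ge_min lexx.
have A2 : A <= p `^ (k%:R / 2) * n%:R / Q by rewrite ge_min lexx orbT.
have A0 : 0 < A.
  rewrite /A lt_min; apply/andP; split; apply: divr_gt0 => //.
  by rewrite mulr_gt0 // powpos.
have C20 : 0 < C ^+ 2 by rewrite exprn_gt0 //; lra.
set q := 1 / C ^+ 2 * A * psi.
have q0 : 0 < q by rewrite /q !mulr_gt0 // invr_gt0.
rewrite Gnp_probE.
pose s := (Num.truncn (n%:R / q)).+1.
have ns : n%:R / q < s%:R by exact: truncnS_gt.
have nsA : C ^+ 2 * n%:R <= s%:R * (A * psi).
  move: (ltW ns); rewrite ler_pdivrMr // => h.
  have -> : s%:R * (A * psi) = C ^+ 2 * (s%:R * q).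
    by rewrite /q; field; rewrite gt_eqF //; lra.
  exact: ler_wpM2l (ltW C20) _ _ h.
have card_n : #|'I_n| = n by exact: card_ord.
(* If s > n, fewer than q colours would give a set larger than the vertex set, so the bound holds
   for every graph. *)
case: (ltnP n s) => sn.
  have -> : prob p (fun G : graph 'I_n => q <= (clique_chromatic_number G)%:R) = 1.
    rewrite -[RHS](expect_cst (T := vpair 'I_n) p); apply: eq_expect => G.
    case: (lerP q) => // hq.
    have cn0 : (0 < #|'I_n|)%N by rewrite card_n.
    have [S Ss _] := few_colors_class q0 (isT : (1 < 2)%N) hq cn0.
    have := max_card (mem S); rewrite Ss card_n => /(leq_trans sn).
    by rewrite ltnn.
  by rewrite lerBlDr lerDl divr_ge0.
have s0 : 0 < s%:R :> R by rewrite ltr0n.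
have deg : C ^+ 2 * (n%:R * p) <= s%:R * psi.
  have h : s%:R * (A * psi) <= s%:R * (1 / p * psi).
    by rewrite ler_wpM2l // ler_wpM2r // ltW.
  have -> : C ^+ 2 * (n%:R * p) = C ^+ 2 * n%:R * p by ring.
  have -> : s%:R * psi = s%:R * (1 / p * psi) * p by field; rewrite gt_eqF.
  exact: ler_wpM2r (ltW p0) _ _ (le_trans nsA h).
have pk2 : (p `^ (k%:R / 2)) ^+ m.+1 = p ^+ 'C(k, 2).
  rewrite -!powR_mulrn ?powR_ge0 ?(ltW p0) // -powRrM; congr (_ `^ _).
  have : ('C(k, 2) * 2)%:R = (k * m.+1)%:R :> R by rewrite bin2_double.
  rewrite !natrM; lra.
have cl : C ^+ 2 * Q <= s%:R * p `^ (k%:R / 2) * psi.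
  have h : s%:R * (A * psi) <= s%:R * (p `^ (k%:R / 2) * n%:R / Q * psi).
    by rewrite ler_wpM2l // ler_wpM2r // ltW.
  have Qn : 0 <= Q / n%:R by rewrite divr_ge0 // ltW.
  have -> : C ^+ 2 * Q = C ^+ 2 * n%:R * (Q / n%:R) by field; rewrite gt_eqF.
  have -> : s%:R * p `^ (k%:R / 2) * psi =
      s%:R * (p `^ (k%:R / 2) * n%:R / Q * psi) * (Q / n%:R).
    by move: (p `^ _) => w; field; rewrite !gt_eqF.
  exact: ler_wpM2r Qn _ _ (le_trans nsA h).
have reg : regime C p L n k s.
  split=> //.
  - by rewrite CE.
  - by apply: le_trans deg _; rewrite ler_piMr.
  - have cQ0 : 0 <= C ^+ 2 * Q by rewrite ltW // mulr_gt0.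
    have := lerXn2r m.+1 cQ0 (le_trans cQ0 cl) cl.
    rewrite [leLHS]exprMn [leRHS]exprMn [(s%:R * _) ^+ _]exprMn psim pk2 Qm -exprM.
    move=> h; apply: le_trans h _.
    by rewrite -mulrA [p ^+ _ * _]mulrC mulrA.
  move=> k3; move: hyp3; rewrite k3 mul1r => /(ler_wpM2l (ltW C20)) /le_trans; apply.
  (* Splitting off psi leaves the power of 1-p^k in the hypothesis. The first entry of the maximum
     is then handled by [deg], the second by [cl] because p^(k/2) p^(-(k-2)/2) = p. *)
  have ph : a ^+ n = a `^ (n%:R * (k%:R - 2) / m.+1%:R) * psi.
    rewrite -powRD; last by rewrite (gt_eqF a0) implybT.
    rewrite -powR_mulrn ?ltW //; congr (_ `^ _).
    have -> : k%:R = m.+1%:R + 1 :> R by rewrite natr1.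
    by move: (m.+1%:R : R) mr => w w0; field; rewrite gt_eqF.
  rewrite ph; set chi := a `^ (n%:R * _ / _).
  have chi0 : 0 < chi by exact: powpos.
  have -> : s%:R * p * (chi * psi) = s%:R * p * psi * chi by ring.
  rewrite mulrA ler_wpM2r ?(ltW chi0) // maxr_pMr ?(ltW C20) // ge_max; apply/andP; split.
    have -> : C ^+ 2 * (n%:R * p ^+ 2) = C ^+ 2 * (n%:R * p) * p by ring.
    have -> : s%:R * p * psi = s%:R * psi * p by ring.
    exact: ler_wpM2r (ltW p0) _ _ deg.
  have e : p `^ (k%:R / 2) * p `^ (- ((k%:R - 2) / 2)) = p.
    rewrite -powRD; last by rewrite (gt_eqF p0) implybT.
    rewrite (_ : k%:R / 2 + _ = 1) ?powRr1 ?ltW //; by field.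
  have w0 : 0 <= p `^ (- ((k%:R - 2) / 2)) by exact: powR_ge0.
  have cl1 : C ^+ 2 <= s%:R * p `^ (k%:R / 2) * psi.
    by apply: le_trans cl; rewrite ler_peMr // ltW.
  apply: le_trans (ler_wpM2r w0 cl1) _.
  by rewrite -[in leRHS]e le_eqVlt; apply/orP; left; apply/eqP; ring.
have P := spread_failure reg card_n.
have sub : prob p (spread (V := 'I_n) k s) <=
    prob p (fun G : graph 'I_n => q <= (clique_chromatic_number G)%:R).
  apply: prob_sub => //; first exact: ltW.
  by move=> G; apply: (spread_chromatic reg card_n).
apply: le_trans sub.
have : prob p (spread (V := 'I_n) k s) + prob p (fun G : graph 'I_n => ~~ spread k s G) = 1.
  rewrite -[RHS](expect_cst (T := vpair 'I_n) p) -expectD; apply: eq_expect => G.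
  by case: (spread k s G); rewrite /= ?addr0 ?add0r.
lra.
Qed.

(** With x = (tau/2) log n, n^tau = e^x e^x >= x^2, and x^2 >= 4 log n once log n >= 16/tau^2. *)
Lemma powR_ge_ln (tau : R) n : 0 < tau -> (0 < n)%N -> expR (16 / tau ^+ 2) <= n%:R ->
  4 * ln n%:R <= n%:R `^ tau :> R.
Proof.
move=> t0 n0 hn; have nr : 0 < n%:R :> R by rewrite ltr0n.
have l1 : 16 / tau ^+ 2 <= ln n%:R by rewrite -ler_expR lnK.
have l0 : 0 <= ln n%:R :> R by apply: le_trans l1; rewrite divr_ge0 // sqr_ge0.
rewrite /powR gt_eqF // (_ : tau * ln n%:R = tau / 2 * ln n%:R + tau / 2 * ln n%:R); last by field.
rewrite expRD; set x := tau / 2 * ln n%:R.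
have x0 : 0 <= x by rewrite mulr_ge0 // divr_ge0 // ltW.
have ex : x <= expR x by have := expR_ge1Dx x; lra.
apply: (@le_trans _ _ (x * x)); last by apply: ler_pM.
have -> : x * x = tau ^+ 2 / 4 * ln n%:R * ln n%:R by rewrite /x; field.
rewrite ler_wpM2r //.
rewrite ler_pdivrMr ?exprn_gt0 // in l1; lra.
Qed.

End FixedSize.

Local Open Scope classical_set_scope.
Local Open Scope ring_scope.

Theorem theorem3 (R : realType) :
  exists C : R, expR 1 <= C /\
  forall (tau : R) (k : nat -> nat) (p : nat -> R),
    0 < tau < 1 ->
    (forall n, (2 <= k n)%N) ->
    (forall n, 0 <= p n <= 1) ->
    (\forall n \near \oo,
       n%:R `^ (-1 + tau) <= p n
       /\ p n <= (6 * C)^-1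
            * ((k n)%:R ^+ 2 * ln (1 / p n) * (n%:R * p n))
                `^ (- (1 / (2 * ((k n)%:R - 1))))
            * (1 - p n ^+ k n) `^ (n%:R / ((k n)%:R - 1))) ->
    (\forall n \near \oo,
       (3 <= k n)%N%:R * (k n)%:R ^+ 5 * ln (1 / p n)
       <= Num.max (n%:R * p n ^+ 2) (p n `^ (- (((k n)%:R - 2) / 2)))
            * (1 - p n ^+ k n)
                `^ (n%:R * ((k n)%:R - 2) / ((k n)%:R - 1))) ->
    Gnp_prob (p n) (fun G : graph 'I_n =>
      1 / C ^+ 2
        * Num.min (1 / p n)
            (p n `^ ((k n)%:R / 2) * n%:R
             / (((k n)`!)%:R * (k n)%:R * ln (1 / p n))
                 `^ (1 / ((k n)%:R - 1)))
        * (1 - p n ^+ k n) `^ (n%:R / ((k n)%:R - 1))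
      <= (clique_chromatic_number G)%:R) @[n --> \oo] --> (1 : R).
Proof.
(* Together with 6Cp <= 1 this value forces e^(L/4) >= 32, whence L >= 8 and 8L <= e^(L/2). *)
exists (32 ^+ 4); split.
  by apply: le_trans (@expR1_le4 R) _; rewrite !exprS expr0; lra.
move=> tau k p /andP[t0 _] k2 p01 hyp2 hyp3.
apply/cvgrPdist_le => e e0; near=> n.
have n2 : (2 <= n)%N by near: n; exact: nbhs_infty_ge.
have nr : 0 < n%:R :> R by rewrite ltr0n; apply: leq_trans n2.
have large : expR (16 / tau ^+ 2) <= n%:R by near: n; exact: nbhs_infty_ger.
have small : 13 / n%:R <= e.
  rewrite ler_pdivrMr // mulrC -ler_pdivrMr //; near: n; exact: nbhs_infty_ger.
have [plow pup] : n%:R `^ (-1 + tau) <= p n /\ p n <= (6 * 32 ^+ 4)^-1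
            * ((k n)%:R ^+ 2 * ln (1 / p n) * (n%:R * p n))
                `^ (- (1 / (2 * ((k n)%:R - 1))))
            * (1 - p n ^+ k n) `^ (n%:R / ((k n)%:R - 1)) by near: n.
have cond : (3 <= k n)%N%:R * (k n)%:R ^+ 5 * ln (1 / p n)
       <= Num.max (n%:R * p n ^+ 2) (p n `^ (- (((k n)%:R - 2) / 2)))
            * (1 - p n ^+ k n)
                `^ (n%:R * ((k n)%:R - 2) / ((k n)%:R - 1)) by near: n.
have pn0 : 0 < p n by apply: lt_le_trans plow; exact: powR_gt0.
have [_ pn1] := andP (p01 n).
have npt : n%:R `^ tau <= n%:R * p n.
  apply: le_trans (ler_wpM2l (ltW nr) plow).
  rewrite -[X in X * _](powRr1 (ltW nr)) -powRD; last by rewrite (gt_eqF nr) implybT.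
  by rewrite addrA subrr add0r.
have np4 : 4 * ln n%:R <= n%:R * p n.
  by apply: le_trans npt; apply: powR_ge_ln => //; apply: leq_trans n2.
have np1 : 1 <= n%:R * p n.
  apply: le_trans npt; rewrite -[leLHS](powRr0 n%:R) ler_powR ?(ltW t0) // ler1n.
  exact: leq_trans n2.
have pn01 : 0 < p n <= 1 by rewrite pn0.
have := chromatic_bound erefl n2 (k2 n) pn01 np4 np1 pup cond.
set P := Gnp_prob _ _ => lowP.
have upP : P <= 1 by rewrite /P Gnp_probE prob_le1 // ltW.
rewrite ger0_norm ?subr_ge0 //; lra.
Unshelve. all: by end_near.
Qed.
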